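(* Let $\tau>-d$. Then for every $t>0$, $$\mathbb{E} L^{(\tau)}_t=\frac{t^2}{2}\int_{B^d(0,\delta_t)}\|y\|^\tau g_W(y)\,\mathrm{d}y$$ and $$0\le \frac{d\kappa_d}{2(\tau+d)}V(W)-\frac{\mathbb{E}L^{(\tau)}_t}{t^2\delta_t^{\tau+d}}\le \frac{\kappa_{d-1}}{2(\tau+d+1)}\,\delta_t\,S(W).$$
   Context: Fix an integer $d\ge 1$. $W\subset\mathbb{R}^d$ is a compact convex set with volume (Lebesgue measure) $V(W)>0$ and surface area $S(W)$. For $t>0$, $\eta_t$ is a homogeneous Poisson point process in $W$ with intensity $t$ (identified with the random finite set of its points), and $(\delta_t:t>0)$ is a family of positive real numbers with $\delta_t\to0$ as $t\to\infty$. $\eta^2_{t,\neq}$ is the set of ordered pairs of distinct points of $\eta_t$, and $$L^{(\tau)}_t:=\frac12\sum_{(x,y)\in\eta^2_{t,\neq}}\mathbf{1}(\|x-y\|\le\delta_t)\,\|x-y\|^\tau .$$ $B^d(0,r)$ is the $d$-dimensional ball of radius $r$ centred at the origin, $\kappa_j$ is the volume of the $j$-dimensional unit ball ($\kappa_0=1$), and $g_W(y):=V(W\cap(W+y))$, $y\in\mathbb{R}^d$, is the covariogram of $W$. *)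

(* Defs.v *)
From HB Require Import structures.
From mathcomp Require Import all_boot all_order all_algebra.
From mathcomp Require Import finmap.
From mathcomp Require Import all_classical all_reals all_analysis.

Set Implicit Arguments.
Unset Strict Implicit.
Unset Printing Implicit Defensive.

Import Order.TTheory GRing.Theory Num.Theory.
Import numFieldNormedType.Exports.

Local Open Scope classical_set_scope.
Local Open Scope ring_scope.

Definition measure_rV_display : measure_display.
Proof. exact: default_measure_display. Qed.

(* The sigma-algebra on R^n generated by the coordinate projections, i.e. the
   Borel sigma-algebra. *)
Section measurable_rV.
Context {R : realType} (n : nat).

Let coors : 'I_n -> 'rV[R]_n -> measurableTypeR R := fun i x => x ord0 i.

Let rV_set0 : g_sigma_preimage coors set0.
Proof. exact: sigma_algebra0. Qed.

Let rV_setC A : g_sigma_preimage coors A -> g_sigma_preimage coors (~` A).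
Proof. exact: sigma_algebraC. Qed.

Let rV_bigcup (F : (set 'rV[R]_n)^nat) :
  (forall i, g_sigma_preimage coors (F i)) ->
  g_sigma_preimage coors (\bigcup_i (F i)).
Proof. exact: sigma_algebra_bigcup. Qed.

HB.instance Definition _ := @isMeasurable.Build measure_rV_display
  'rV[R]_n (g_sigma_preimage coors) rV_set0 rV_setC rV_bigcup.

End measurable_rV.

Section lebesgue_measure_rV.
Context {R : realType}.

Definition cons_rV n (p : measurableTypeR R * 'rV[R]_n) : 'rV[R]_n.+1 :=
  row_mx (p.1)%:M p.2 : 'rV[R]_(1 + n).

Fixpoint volume (n : nat) : set 'rV[R]_n -> \bar R :=
  match n with
  | 0 => \d_(0 : 'rV[R]_0)
  | m.+1 => pushforward (@lebesgue_measure R \x @volume m)%E (@cons_rV m)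
  end.

Lemma measurable_coord n (i : 'I_n) :
  measurable_fun setT (fun x : 'rV[R]_n => x ord0 i : measurableTypeR R).
Proof.
move=> _ Y mY; rewrite setTI; apply: sub_sigma_algebra => /=.
rewrite -bigcup_seq/=; exists i => /=; first by rewrite mem_index_enum.
by exists Y => //; rewrite setTI.
Qed.

Lemma measurable_rVP d (T : measurableType d) n (f : T -> 'rV[R]_n) :
  (forall i, measurable_fun setT (fun t => f t ord0 i : measurableTypeR R)) ->
  measurable_fun setT f.
Proof.
move=> mf _ Y mY; rewrite setTI.
suff: g_sigma_preimage (fun i (x : 'rV[R]_n) => x ord0 i : measurableTypeR R)
   `<=` [set A | measurable (f @^-1` A)] by exact.
apply: smallest_sub.
  split => /=.
  - by rewrite preimage_set0.
  - by move=> A mA; rewrite setTD -preimage_setC; exact: measurableC.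
  - by move=> F mF; rewrite preimage_bigcup; exact: bigcup_measurable.
move=> A; rewrite -bigcup_seq => -[/= i _ [B mB <-]].
by rewrite setTI -comp_preimage -[X in measurable X]setTI; exact: mf.
Qed.

Lemma measurable_cons_rV n : measurable_fun setT (@cons_rV n).
Proof.
apply: measurable_rVP => i.
have [j ->|j ->] := @split_ordP 1 n i.
  rewrite (_ : (fun _ => _) = fst); first exact: measurable_fst.
  apply/funext => p; rewrite [LHS](row_mxEl (p.1)%:M p.2 ord0 j).
  by rewrite mxE (ord1 j) eqxx mulr1n.
rewrite (_ : (fun _ => _) = (fun x : 'rV[R]_n => x ord0 j) \o snd).
  by apply: measurableT_comp => //; exact: measurable_coord.
by apply/funext => p; rewrite [LHS](row_mxEr (p.1)%:M p.2 ord0 j).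
Qed.


Definition uncons_rV n (x : 'rV[R]_n.+1) : measurableTypeR R * 'rV[R]_n :=
  (x ord0 ord0, @rsubmx R 1 1 n x).

Lemma uncons_rVK n : cancel (@uncons_rV n) (@cons_rV n).
Proof.
move=> x; rewrite -[RHS](@hsubmxK _ 1 1 n x).
suff -> : @lsubmx R 1 1 n x = (x ord0 ord0)%:M by [].
apply/rowP => i; rewrite !mxE (ord1 i) eqxx mulr1n.
by congr (fun_of_matrix x _ _); exact/val_inj.
Qed.

Lemma measurable_uncons_rV n : measurable_fun setT (@uncons_rV n).
Proof.
apply/measurable_fun_pair; first exact: measurable_coord.
apply: measurable_rVP => i.
rewrite (_ : (fun _ => _) = (fun x : 'rV[R]_n.+1 => x ord0 (@rshift 1 n i))).
  exact: measurable_coord.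
by apply/funext => x; rewrite mxE.
Qed.

Section volumeS.
Context (n : nat) (mu : {sigma_finite_measure set 'rV[R]_n -> \bar R}).
Local Open Scope ereal_scope.

Let prod := (@lebesgue_measure R \x mu).

HB.instance Definition _ := Measure.on prod.

Let vol := pushforward prod (@cons_rV n).

Let mpre A : measurable A -> measurable (@cons_rV n @^-1` A).
Proof. by move=> mA; rewrite -[X in measurable X]setTI; exact: measurable_cons_rV. Qed.

Let vol0 : vol set0 = 0.
Proof. by rewrite /vol /pushforward preimage_set0 measure0. Qed.

Let vol_ge0 A : 0 <= vol A.
Proof. exact: (measure_ge0 prod). Qed.

Let vol_sigma_additive : semi_sigma_additive vol.
Proof.
move=> F mF tF mUF; rewrite /vol /pushforward preimage_bigcup.
apply: measure_semi_sigma_additive.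
- by move=> k; exact: mpre.
- apply/trivIsetP => /= i j _ _ ij; rewrite -preimage_setI.
  by move/trivIsetP : tF => /(_ _ _ _ _ ij) ->//; rewrite preimage_set0.
- by rewrite -preimage_bigcup; exact: mpre.
Qed.

HB.instance Definition _ := isMeasure.Build _ _ _ vol
  vol0 vol_ge0 vol_sigma_additive.

Let prod_sigma_finite : sigma_finite setT prod.
Proof.
have /sigma_finiteP[F [TF ndF Foo]] := sigma_finiteT (@lebesgue_measure R).
have /sigma_finiteP[G [TG ndG Goo]] := sigma_finiteT mu.
exists (fun k => F k `*` G k).
  rewrite -setXTT TF TG predeqE => -[x y]; split.
    move=> [/= [k _ Fkx] [l _ Gly]]; exists (maxn k l) => //; split.
    - by move: x Fkx; exact/subsetPset/ndF/leq_maxl.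
    - by move: y Gly; exact/subsetPset/ndG/leq_maxr.
  by move=> [k _ []/= ? ?]; split; exists k.
move=> k; have [? ?] := Foo k; have [? ?] := Goo k.
split; first exact: measurableX.
by rewrite /prod product_measure1E// lte_mul_pinfty// ge0_fin_numE.
Qed.

Let vol_sigma_finite : sigma_finite setT vol.
Proof.
have [F TF Foo] := prod_sigma_finite.
exists (fun k => @uncons_rV n @^-1` F k).
  by rewrite -preimage_bigcup -TF preimage_setT.
have mF' k : measurable (@uncons_rV n @^-1` F k).
  rewrite -[X in measurable X]setTI; apply: measurable_uncons_rV => //.
  by have [] := Foo k.
move=> k; have [mF Fk] := Foo k; split=> //.
apply: le_lt_trans Fk; rewrite /vol /pushforward le_measure ?inE//.
  exact: mpre.
move=> p /=; suff -> : uncons_rV (cons_rV p) = p by [].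
rewrite [LHS]surjective_pairing [RHS]surjective_pairing; congr pair => /=.
  rewrite (_ : ord0 = @lshift 1 n ord0); last exact/val_inj.
  by rewrite [LHS](row_mxEl (p.1)%:M p.2) mxE eqxx mulr1n.
by rewrite [LHS]row_mxKr.
Qed.

HB.instance Definition _ := Measure_isSigmaFinite.Build _ _ _ vol
  vol_sigma_finite.

Lemma volumeS_sigma_finite :
  exists nu : {sigma_finite_measure set 'rV[R]_n.+1 -> \bar R},
    pushforward (@lebesgue_measure R \x mu) (@cons_rV n) = nu.
Proof. by exists vol. Qed.

End volumeS.

Lemma volume_sigma_finite_measure n :
  exists mu : {sigma_finite_measure set 'rV[R]_n -> \bar R}, @volume n = mu.
Proof.
elim: n => [|n [mu muE]]; first by exists \d_(0 : 'rV[R]_0).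
by have [nu nuE] := volumeS_sigma_finite mu; exists nu; rewrite /= muE.
Qed.

Section volume_measure.
Context (n : nat).

Let volume0 : @volume n set0 = 0%E.
Proof. by have [mu ->] := volume_sigma_finite_measure n; exact: measure0. Qed.

Let volume_ge0 A : (0 <= @volume n A)%E.
Proof. by have [mu ->] := volume_sigma_finite_measure n; exact: measure_ge0. Qed.

Let volume_sigma_additive : semi_sigma_additive (@volume n).
Proof.
have [mu ->] := volume_sigma_finite_measure n.
exact: measure_semi_sigma_additive.
Qed.

HB.instance Definition _ := isMeasure.Build _ _ _ (@volume n)
  volume0 volume_ge0 volume_sigma_additive.

Let volume_sigma_finite : sigma_finite setT (@volume n).
Proof.
by have [mu ->] := volume_sigma_finite_measure n; exact: sigma_finiteT.
Qed.

HB.instance Definition _ := Measure_isSigmaFinite.Build _ _ _ (@volume n)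
  volume_sigma_finite.

End volume_measure.

End lebesgue_measure_rV.

Arguments volume {R n} _.

Section convex_geometry.
Context {R : realType}.

(* The norm that MathComp-Analysis puts on 'rV[R]_d is the sup norm. *)
Definition enorm d (x : 'rV[R]_d) : R := Num.sqrt (\sum_(i < d) x ord0 i ^+ 2).

Definition eball d (r : R) : set 'rV[R]_d := [set x | enorm x <= r].

Definition kappa (j : nat) : R := fine (volume (@eball j 1)).

Definition covariogram d (W : set 'rV[R]_d) (y : 'rV[R]_d) : \bar R :=
  volume (W `&` [set w + y | w in W]).

Definition parallel_body d (W : set 'rV[R]_d) (e : R) : set 'rV[R]_d :=
  [set w + b | w in W & b in eball e].

(* Surface area of a convex body in the sense of Minkowski,
   S(W) = lim_{e -> 0+} (V(W + e B) - V(W)) / e. *)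
Definition surface_area d (W : set 'rV[R]_d) : \bar R :=
  lim ((volume (parallel_body W e) - volume W) * (e^-1)%:E @[e --> 0^'+])%E.

End convex_geometry.

Section poisson_point_process.
Context {R : realType} {d : nat} {disp : measure_display}
  {Omega : measurableType disp} (P : probability Omega R).

(* A point process is given by the random set of its points. *)
Definition point_count (eta : Omega -> set 'rV[R]_d) (A : set 'rV[R]_d)
  (w : Omega) : nat := #|` fset_set (eta w `&` A)|.

Definition poisson_process (W : set 'rV[R]_d) (t : R)
    (eta : Omega -> set 'rV[R]_d) : Prop :=
  [/\ forall w, finite_set (eta w) /\ eta w `<=` W,
      forall A, measurable A -> measurable_fun setT (point_count eta A),
      (* the second argument of poisson_prob is a dummy; poisson_prob 0 is the
         Dirac mass at 0 *)
      forall A, measurable A -> forall U : set nat,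
        P (point_count eta A @^-1` U) =
          poisson_prob (t * fine (volume (A `&` W))) 0 U
    & forall n (A : 'I_n -> set 'rV[R]_d) (k : 'I_n -> nat),
        (forall i, measurable (A i)) -> trivIset setT A ->
        P (\bigcap_i (point_count eta (A i) @^-1` [set k i])) =
          (\prod_(i < n) P (point_count eta (A i) @^-1` [set k i]))%E].

End poisson_point_process.

Section edge_lengths.
Context {R : realType} {d : nat}.

Definition distinct_pairs (X : set 'rV[R]_d) : set ('rV[R]_d * 'rV[R]_d) :=
  [set p | [/\ X p.1, X p.2 & p.1 <> p.2]].

Definition length_power (tau delta : R) (X : set 'rV[R]_d) : R :=
  2^-1 * \sum_(p \in distinct_pairs X)
    ((enorm (p.1 - p.2) <= delta)%R%:R * enorm (p.1 - p.2) `^ tau).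

End edge_lengths.

(* Main.v *)
Require Import Defs.
From HB Require Import structures.
From mathcomp Require Import all_boot all_order all_algebra.
From mathcomp Require Import finmap ring lra.
From mathcomp Require Import all_classical all_reals all_analysis measurable_realfun.

Set Implicit Arguments.
Unset Strict Implicit.
Unset Printing Implicit Defensive.

Import Order.TTheory GRing.Theory Num.Theory.
Import numFieldNormedType.Exports.

Local Open Scope classical_set_scope.
Local Open Scope ring_scope.

(** Campbell's formula for the second factorial moment measure of a Poisson
    process, which is the square of the intensity measure, gives the expected
    length as [t^2 / 2] times the integral of [|x - y|^tau] over the pairs of
    points of [W] at distance at most [delta]; substituting [x = y + z] and
    integrating in [y] first, the covariogram appears
    ([poisson_pair_campbell], [integral_covariogram],
    [expected_length_power]). The moment measure is identified on rectangles
    [A `*` B], where the number of off-diagonal pairs is a sum of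
    [n_C (n_C - 1)], [C = A `&` B], and of products of counts of disjoint sets.
    The former has a Poisson factorial moment; the latter follow by polarization
    from the fact that the counts of two disjoint sets and of their union are
    all Poisson. Dynkin's theorem and approximation by simple functions do the
    rest.

    Write [deficit W y = V(W) - g_W(y) = V((W + y) \ W)]. The integral of
    [|y|^tau] over the ball of radius [delta] is
    [delta^(tau + d) d kappa_d / (tau + d)], so the quantity to be bounded is
    the integral of [|y|^tau deficit W y] over that ball, divided by
    [2 delta^(tau + d)] ([limit_sub_mean]). It is nonnegative, and the upper
    bound amounts to [deficit_integral_le]:
    the integral is at most
    [delta^(tau + d + 1) kappa_(d-1) / (tau + d + 1) S(W)].

    The surface area is known only through the volumes of the parallel bodies
    [W + e B] for small [e], so the bound is proved for short displacements:
    the deficit is subadditive, whence [deficit (k y) <= k deficit y], and long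
    displacements reduce to short ones. At a small scale [e] fix [x] outside
    [W], with nearest point [p] in [W], and put [u = (x - p) / |x - p|]. By
    convexity, [x - e y] can be in [W] only if [|x - p| <= e <u, y>]. A
    reflection exchanging [u] with the first basis vector preserves the weight
    [|y|^tau] and the ball, so integrating in [y] first, the condition may be
    replaced by [|x - p| <= e height y], where [height y] is the positive part
    of the first coordinate ([cap_le]). Integrating now in [x], the weighted
    deficit at scale [e] is at most the integral of
    [|y|^tau (V(W + e (height y) B) - V(W))], which is asymptotically at most
    [e S(W)] times the integral of [|y|^tau height y] over the unit ball, that
    is [kappa_(d-1) / (tau + d + 1)] ([integral_enorm_powR_height]).

    For this the limit that defines [S(W)] has to exist
    ([surface_area_cvg]). By the Brunn-Minkowski inequality, obtained from the
    one-dimensional Prekopa-Leindler inequality by induction on the dimension,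
    the volume of [W + e B] is log-concave in [e]; hence its inverse is convex
    and its difference quotients at 0 are monotone. The behaviour of the volume
    under homotheties and reflections comes from the uniqueness of a
    translation invariant measure ([volume_additive_image]). *)

(** * The Euclidean norm *)

Section euclidean_norm.
Context {R : realType} {d : nat}.
Implicit Types x y : 'rV[R]_d.

Definition dotp x y : R := \sum_(i < d) x ord0 i * y ord0 i.

Lemma dotpC x y : dotp x y = dotp y x.
Proof. by apply: eq_bigr => i _; rewrite mulrC. Qed.

Lemma dotpDl x y z : dotp (x + y) z = dotp x z + dotp y z.
Proof. by rewrite /dotp -big_split; apply: eq_bigr => i _; rewrite mxE mulrDl. Qed.

Lemma dotpZl a x z : dotp (a *: x) z = a * dotp x z.
Proof. by rewrite /dotp mulr_sumr; apply: eq_bigr => i _; rewrite mxE mulrA. Qed.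

Lemma dotpDr x y z : dotp z (x + y) = dotp z x + dotp z y.
Proof. by rewrite dotpC dotpDl !(dotpC z). Qed.

Lemma dotpZr a x z : dotp z (a *: x) = a * dotp z x.
Proof. by rewrite dotpC dotpZl (dotpC z). Qed.

Lemma dotpNl x z : dotp (- x) z = - dotp x z.
Proof. by rewrite -scaleN1r dotpZl mulN1r. Qed.

Lemma dotpNr x z : dotp z (- x) = - dotp z x.
Proof. by rewrite dotpC dotpNl dotpC. Qed.

Lemma dotp_ge0 x : 0 <= dotp x x.
Proof. by apply: sumr_ge0 => i _; rewrite -expr2 sqr_ge0. Qed.

Lemma dotp_eq0 x : (dotp x x == 0) = (x == 0).
Proof.
apply/idP/eqP => [|->]; last first.
  by rewrite /dotp big1// => i _; rewrite mxE mul0r.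
rewrite psumr_eq0 => [/allP x0|i _]; last by rewrite -expr2 sqr_ge0.
apply/rowP => i; rewrite mxE; apply/eqP.
by rewrite -sqrf_eq0 expr2; exact: (implyP (x0 i (mem_index_enum i))).
Qed.

Lemma enorm_dotp x : enorm x = Num.sqrt (dotp x x).
Proof. by congr Num.sqrt; apply: eq_bigr => i _; rewrite expr2. Qed.

Lemma sqr_enorm x : enorm x ^+ 2 = dotp x x.
Proof. by rewrite enorm_dotp sqr_sqrtr// dotp_ge0. Qed.

Lemma enorm_ge0 x : 0 <= enorm x.
Proof. exact: sqrtr_ge0. Qed.

Lemma enorm_eq0 x : (enorm x == 0) = (x == 0).
Proof. by rewrite -dotp_eq0 -sqr_enorm sqrf_eq0. Qed.

Lemma enorm0 : enorm (0 : 'rV[R]_d) = 0.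
Proof. by apply/eqP; rewrite enorm_eq0. Qed.

Lemma enorm_gt0 x : (0 < enorm x) = (x != 0).
Proof. by rewrite lt_neqAle enorm_ge0 andbT eq_sym enorm_eq0. Qed.

Lemma enormZ a x : enorm (a *: x) = `|a| * enorm x.
Proof.
rewrite !enorm_dotp dotpZl dotpZr mulrA -expr2.
by rewrite sqrtrM ?sqr_ge0// sqrtr_sqr.
Qed.

Lemma enormN x : enorm (- x) = enorm x.
Proof. by rewrite -scaleN1r enormZ normrN1 mul1r. Qed.

(** Expand the square of the norm of [enorm y *: x - enorm x *: y]. *)
Lemma dotp_le_enorm x y : dotp x y <= enorm x * enorm y.
Proof.
have [->|x0] := eqVneq x 0.
  by rewrite enorm0 mul0r /dotp big1// => i _; rewrite mxE mul0r.
have [->|y0] := eqVneq y 0.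
  by rewrite enorm0 mulr0 /dotp big1// => i _; rewrite mxE mulr0.
move: x0 y0; rewrite -!enorm_gt0 => x0 y0.
have := dotp_ge0 (enorm y *: x - enorm x *: y).
rewrite !(dotpDl, dotpDr, dotpNl, dotpNr, dotpZl, dotpZr) -!sqr_enorm (dotpC y).
set a := enorm x in x0 *; set b := enorm y in y0 *; set p := dotp x y => h.
have {h} : 0 <= 2 * (a * b) * (a * b - p) by lra.
by rewrite pmulr_rge0 ?subr_ge0// !mulr_gt0.
Qed.

Lemma ler_enormD x y : enorm (x + y) <= enorm x + enorm y.
Proof.
rewrite -(@ler_pXn2r _ 2) ?nnegrE ?addr_ge0 ?enorm_ge0//.
rewrite sqr_enorm !(dotpDl, dotpDr) sqrrD -!sqr_enorm (dotpC y).
by have := dotp_le_enorm x y; lra.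
Qed.

Lemma coord_le_enorm x i : `|x ord0 i| <= enorm x.
Proof.
rewrite -sqrtr_sqr ler_wsqrtr// (bigD1 i)//= lerDl.
by apply: sumr_ge0 => j _; rewrite sqr_ge0.
Qed.

Lemma enorm_le_coord x (r : R) :
  0 <= r -> (forall i, `|x ord0 i| <= r) -> enorm x <= d%:R * r.
Proof.
move=> r0 xr; rewrite -[leRHS]ger0_norm ?mulr_ge0// -sqrtr_sqr ler_wsqrtr//.
apply: (@le_trans _ _ (\sum_(i < d) r ^+ 2)).
  apply: ler_sum => i _.
  by rewrite -(@real_normK _ (x ord0 i)) ?num_real// ler_pXn2r ?nnegrE.
rewrite sumr_const card_ord -[leLHS]mulr_natl exprMn ler_wpM2r ?sqr_ge0//.
by rewrite -natrX ler_nat; case: d => // n; rewrite expnS expn1 leq_pmulr.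
Qed.

Lemma eball_gt0_center (r : R) : 0 <= r -> eball r (0 : 'rV[R]_d).
Proof. by rewrite /eball /= enorm0. Qed.

End euclidean_norm.

(** * Borel structure of the space of row vectors *)

Section borel_rV.
Context {R : realType}.

Lemma measurable_rV_coord {dT} {T : measurableType dT} {d}
    (f : T -> 'rV[R]_d) (i : 'I_d) :
  measurable_fun setT f -> measurable_fun setT (fun t => f t ord0 i).
Proof. exact: measurableT_comp (measurable_coord i). Qed.

Lemma measurable_rV_add {dT} {T : measurableType dT} {d} (f g : T -> 'rV[R]_d) :
  measurable_fun setT f -> measurable_fun setT g ->
  measurable_fun setT (fun t => f t + g t).
Proof.
move=> mf mg; apply: measurable_rVP => i.
under eq_fun do rewrite mxE.
by apply: measurable_funD; exact: measurable_rV_coord.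
Qed.

Lemma measurable_rV_scale {dT} {T : measurableType dT} {d}
    (a : T -> R) (f : T -> 'rV[R]_d) :
  measurable_fun setT a -> measurable_fun setT f ->
  measurable_fun setT (fun t => a t *: f t).
Proof.
move=> ma mf; apply: measurable_rVP => i.
under eq_fun do rewrite mxE.
by apply: measurable_funM => //; exact: measurable_rV_coord.
Qed.

Lemma measurable_rV_opp {dT} {T : measurableType dT} {d} (f : T -> 'rV[R]_d) :
  measurable_fun setT f -> measurable_fun setT (fun t => - f t).
Proof.
move=> mf; under eq_fun do rewrite -scaleN1r.
exact: measurable_rV_scale.
Qed.

Lemma measurable_dotp {d} (u : 'rV[R]_d) : measurable_fun setT (dotp u).
Proof.
apply: measurable_sum => i; apply: measurable_funM => //; exact: measurable_coord.
Qed.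

Lemma measurable_enorm {d} : measurable_fun setT (@enorm R d).
Proof.
apply: (measurableT_comp (f := @Num.sqrt R)).
  by apply: continuous_measurable_fun; exact: sqrt_continuous.
by apply: measurable_sum => i; apply: measurable_funX; exact: measurable_coord.
Qed.

Lemma measurable_preimage {d1 d2} {T1 : measurableType d1}
    {T2 : measurableType d2} (f : T1 -> T2) (A : set T2) :
  measurable_fun setT f -> measurable A -> measurable (f @^-1` A).
Proof. by move=> mf mA; rewrite -[X in measurable X]setTI; exact: mf. Qed.

Lemma measurable_eball {d} (r : R) : measurable (@eball R d r).
Proof.
rewrite (_ : eball r = @enorm R d @^-1` `]-oo, r]%classic); last first.
  by apply/seteqP; split => x /=; rewrite in_itv.
exact: measurable_preimage measurable_enorm (measurable_itv _).
Qed.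

(** Second countability: an open set is the union of the sup-norm balls with
    rational centre and radius [1 / (k + 1)] that it contains. *)
Lemma open_measurable_rV {d} (U : set 'rV[R]_d) : open U -> measurable U.
Proof.
move=> oU.
pose c (q : {ffun 'I_d -> rat}) : 'rV[R]_d := \row_i ratr (q i).
pose D := [set p : {ffun 'I_d -> rat} * nat | ball (c p.1) p.2.+1%:R^-1 `<=` U].
have mB (x : 'rV[R]_d) e : 0 < e -> measurable (ball x e).
  move=> e0.
  have -> : ball x e =
      \bigcap_(i in [set` (enum 'I_d)]) [set y | ball (x ord0 i) e (y ord0 i)].
    apply/seteqP; split => [y [_ xy] i _|y xy]; first exact: xy.
    by split=> // j i; rewrite (ord1 j); apply: xy => /=; rewrite mem_enum.
  apply: fin_bigcap_measurable => // i _.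
  apply: (measurable_preimage (measurable_coord i)).
  exact: open_measurable (ball_open _ _).
suff -> : U = \bigcup_p (if `[< D p >] then ball (c p.1) p.2.+1%:R^-1 else set0).
  apply: countable_bigcupT_measurable => // p.
  by case: ifP => // _; apply: mB; rewrite invr_gt0.
apply/seteqP; split=> [x Ux|x [p _]]; last first.
  by case: asboolP => // Dp xp; exact: Dp.
have /nbhs_ballP[e /= e0 eU] : nbhs x U by exact: open_nbhs_nbhs.
have [k ke] : exists k : nat, k.+1%:R^-1 < e / 2.
  have := @near_infty_natSinv_lt R (PosNum (divr_gt0 e0 (ltr0n R 2))).
  by move=> /filter_ex[k]; exists k.
have qP i : exists q : rat, ball (x ord0 i) k.+1%:R^-1 (ratr q).
  have [] := @dense_rat R (ball (x ord0 i) k.+1%:R^-1).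
  - by exists (x ord0 i); exact: ballxx.
  - exact: ball_open.
  - by move=> r [rx [q _ qr]]; exists q; rewrite qr.
have [q xq] := choice qP.
pose p : {ffun 'I_d -> rat} * nat := ([ffun i => q i], k).
have cx : ball (c p.1) p.2.+1%:R^-1 x.
  split=> [|j i]; first by rewrite invr_gt0.
  by rewrite (ord1 j) mxE ffunE; exact/ball_sym/xq.
exists p => //; case: asboolP => // -[] y py; apply: eU.
rewrite [e]splitr; apply: (@ball_triangle _ _ (c p.1)).
  by apply/ball_sym; apply: le_ball cx; exact: ltW.
by apply: le_ball py; exact: ltW.
Qed.

Lemma closed_measurable_rV {d} (A : set 'rV[R]_d) : closed A -> measurable A.
Proof.
move=> cA; rewrite -(setCK A); apply: measurableC.
by apply: open_measurable_rV; exact: closed_openC.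
Qed.

Lemma compact_measurable_rV {d} (A : set 'rV[R]_d) : compact A -> measurable A.
Proof.
by move=> /(compact_closed (@norm_hausdorff _ _)); exact: closed_measurable_rV.
Qed.

Lemma continuous_enorm {d} : continuous (@enorm R d).
Proof.
move=> x; apply: continuous_comp; last exact: sqrt_continuous.
move: x; apply: continuous_big => [|i _ y]; first exact: add_continuous.
apply: (@continuous_comp _ _ _ (fun y : 'rV[R]_d => y ord0 i) (fun r => r ^+ 2)).
  exact: coord_continuous.
exact: exprn_continuous.
Qed.

End borel_rV.

(** * Invariance properties of the volume *)

(** The measure structure of an image measure in general: inference on
    [pushforward] finds the one that was made for [volume]. *)
Local Notation image_measure :=
  measure_function_pushforward__canonical__measure_function_Measure.

Section change_of_variables.
Local Open Scope ereal_scope.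
Context {d1 d2} {T1 : measurableType d1} {T2 : measurableType d2} {R : realType}.
Variables (mu : {measure set T1 -> \bar R}) (nu : {measure set T2 -> \bar R}).
Variables (phi : T1 -> T2) (c : {nonneg R}).
Hypothesis mphi : measurable_fun setT phi.
Hypothesis phiE : forall A, measurable A -> mu (phi @^-1` A) = c%:num%:E * nu A.

(** To be applied to translations, homotheties and reflections, which multiply
    volumes by a constant. *)
Lemma ge0_integral_change (D : set T2) (f : T2 -> \bar R) :
  measurable D -> measurable_fun D f -> (forall y, D y -> 0 <= f y) ->
  \int[mu]_(x in phi @^-1` D) f (phi x) = c%:num%:E * \int[nu]_(y in D) f y.
Proof.
move=> mD mf f0; rewrite -ge0_integral_mscale//.
rewrite -(ge0_integral_pushforward mphi mu mD mf); last first.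
  by move=> y /set_mem/f0.
by apply: (eq_measure_integral _ (m1 := image_measure mu mphi)) => A mA _;
  exact: phiE.
Qed.

End change_of_variables.

Section volume_transformations.
Context {R : realType}.
Local Open Scope ereal_scope.
Local Notation leb := (@lebesgue_measure R).

Lemma lebesgue_measureD (v : R) (A : set (measurableTypeR R)) : measurable A ->
  leb ((fun x => x + v)%R @^-1` A) = leb A.
Proof.
have mv : measurable_fun [set: measurableTypeR R]
   (fun x => x + v : measurableTypeR R)%R.
  exact: measurable_funD.
move=> mA; apply/esym/(lebesgue_measure_unique (mu := image_measure _ mv)) => // _ [[a b]] _ <-.
rewrite /pushforward /=.
rewrite [X in _ = lebesgue_measure X](_ : _ = `](a - v)%R, (b - v)%R]%classic); last first.
  by apply/seteqP; split => x; rewrite /= !in_itv/= ltrBlDr lerBrDr.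
rewrite !lebesgue_measure_itv/= !lte_fin ltrD2r -!EFinB.
by rewrite opprD addrACA subrr addr0.
Qed.

Lemma volumeS n (A : set 'rV[R]_n.+1) :
  volume A = \int[leb]_s volume [set y : 'rV[R]_n | A (cons_rV (s, y))].
Proof.
rewrite /= /pushforward /product_measure1; apply: eq_integral => s _ /=.
by congr (volume _); apply/seteqP; split => y; rewrite /xsection /= inE.
Qed.

Lemma ge0_integral_volumeS n (f : 'rV[R]_n.+1 -> \bar R) :
  measurable_fun setT f -> (forall x, 0 <= f x) ->
  \int[volume]_x f x = \int[leb]_s \int[volume]_y f (cons_rV (s, y)).
Proof.
move=> mf f0.
rewrite /= (ge0_integral_pushforward (@measurable_cons_rV R n) _ measurableT mf).
rewrite preimage_setT (fubini_tonelli1 (f \o @cons_rV R n))//.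
- by apply: measurableT_comp => //; exact: measurable_cons_rV.
- by move=> x /=; exact: f0.
- by move=> x _; exact: f0.
Qed.

Lemma cons_rVD n (p q : measurableTypeR R * 'rV[R]_n) :
  cons_rV (p.1 + q.1, p.2 + q.2)%R = (cons_rV p + cons_rV q)%R.
Proof.
apply/rowP => i; rewrite !mxE; case: splitP => j _; rewrite !mxE//.
by rewrite mulrnDl.
Qed.

(** Induction on the dimension: translating a set translates its slices and
    shifts their positions. *)
Lemma volumeD n (v : 'rV[R]_n) (A : set 'rV[R]_n) : measurable A ->
  volume ((fun x => x + v)%R @^-1` A) = volume A.
Proof.
elim: n v A => [v A _|n ih v A mA].
  by congr (volume _); apply/seteqP; split => x /=; rewrite (thinmx0 v) addr0.
rewrite !volumeS -[v]uncons_rVK.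
pose g (s : measurableTypeR R) := volume [set y : 'rV[R]_n | A (cons_rV (s, y))].
have mcA : measurable (@cons_rV R n @^-1` A).
  exact: measurable_preimage (@measurable_cons_rV R n) mA.
have gE s : g s = volume (xsection (@cons_rV R n @^-1` A) s).
  by congr (volume _); apply/seteqP; split => y; rewrite /xsection /= inE.
have mg : measurable_fun setT g.
  by apply: (eq_measurable_fun _ _ (measurable_fun_xsection (@volume R n) mcA)).
transitivity (\int[leb]_s g (s + (uncons_rV v).1)%R).
  apply: eq_integral => s _; rewrite gE -[RHS](ih (uncons_rV v).2); last first.
    exact: measurable_xsection.
  congr (volume _); apply/seteqP; split => y /=;
    by rewrite /xsection /= inE /= -cons_rVD.
pose a : measurableTypeR R := (uncons_rV v).1.
rewrite -[LHS]/(\int[leb]_(s in (fun x => x + a)%R @^-1` setT) g (s + a)%R).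
rewrite (@ge0_integral_change _ _ _ _ _ leb leb _ (1%:nng)%R)//; first by rewrite mul1e.
  exact: measurable_funD.
by move=> B mB; rewrite mul1e; exact: lebesgue_measureD.
Qed.

Lemma ge0_integral_volumeD n (v : 'rV[R]_n) (f : 'rV[R]_n -> \bar R) :
  measurable_fun setT f -> (forall x, 0 <= f x) ->
  \int[volume]_x f (x + v)%R = \int[volume]_x f x.
Proof.
move=> mf f0; rewrite -[LHS]/(\int[volume]_(s in (fun x => x + v)%R @^-1` setT) f (s + v)%R).
rewrite (@ge0_integral_change _ _ _ _ _ (@volume R n) (@volume R n) _ (1%:nng)%R)//.
- by rewrite mul1e.
- by apply: measurable_rV_add => //; exact: measurable_cst.
- by move=> B mB; rewrite mul1e; exact: volumeD.
Qed.

End volume_transformations.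

Section linear_images.
Context {R : realType} {d : nat}.
Local Open Scope ereal_scope.

Lemma measurable_indic_comp {d1 d2} {T1 : measurableType d1}
    {T2 : measurableType d2} (A : set T2) (h : T1 -> T2) :
  measurable A -> measurable_fun setT h ->
  measurable_fun setT (fun t => (\1_A (h t))%:E : \bar R).
Proof.
by move=> mA mh; apply/measurable_EFinP; apply: measurableT_comp mh.
Qed.

Lemma integral_volume_indic (A : set 'rV[R]_d) : measurable A ->
  \int[volume]_x (\1_A x)%:E = volume A.
Proof. by move=> mA; rewrite -[in RHS](setIT A); exact: integral_indic. Qed.

Let prod_indic (f g : 'rV[R]_d -> 'rV[R]_d) (A B : set 'rV[R]_d) :
  measurable_fun setT f -> measurable_fun setT g ->
  measurable A -> measurable B ->
  \int[volume]_x \int[volume]_y ((\1_A (f x))%:E * (\1_B (y + g x)%R)%:E) =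
  volume (f @^-1` A) * volume B.
Proof.
move=> mf mg mA mB.
transitivity (\int[volume]_x ((\1_(f @^-1` A) x)%:E * volume B)).
  apply: eq_integral => x _; rewrite ge0_integralZl//; last first.
    apply: measurable_indic_comp => //.
    by apply: measurable_rV_add => //; exact: measurable_cst.
  congr (_ * _).
  rewrite (ge0_integral_volumeD (g x) (f := fun y => (\1_B y)%:E))//=.
    exact: integral_volume_indic.
  exact: measurable_indic_comp.
have mfA : measurable (f @^-1` A) by exact: measurable_preimage mA.
rewrite ge0_integralZr//; first by congr (_ * _); exact: integral_volume_indic.
exact: measurable_indic_comp mA mf.
Qed.

(** For fixed [B] this says that [volume (f @^-1` A)] is proportional to
    [volume A], as for any two translation invariant measures. The left-hand
    side is the double integral of [1_A (f x) 1_B (y - f x)]. For each [y],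
    translating [x] by some [w] with [f w = y] turns the integrand into
    [1_A (y + f x) 1_B (- f x)], whose double integral is the right-hand side
    since [B] is symmetric. *)
Lemma volume_additive_image (f : 'rV[R]_d -> 'rV[R]_d) (A B : set 'rV[R]_d) :
  measurable_fun setT f -> {morph f : x y / (x + y)%R} ->
  (forall y, exists x, f x = y) ->
  measurable A -> measurable B -> (forall x, B (- x)%R -> B x) ->
  volume (f @^-1` A) * volume B = volume (f @^-1` B) * volume A.
Proof.
move=> mf fD f_surj mA mB BN.
have f0 : f 0%R = 0%R by apply: (addrI (f 0%R)); rewrite -fD !addr0.
have fN x : f (- x)%R = (- f x)%R.
  by apply: (addrI (f x)); rewrite -fD !subrr.
have mfN : measurable_fun setT (fun x => - f x)%R by exact: measurable_rV_opp.
rewrite -(prod_indic mf mfN mA mB) -(prod_indic mf mf mB mA).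
rewrite (fubini_tonelli (fun p : 'rV[R]_d * 'rV[R]_d => (\1_A (f p.1))%:E * (\1_B (p.2 - f p.1)%R)%:E))/=; last 2 first.
- apply: emeasurable_funM; apply: measurable_indic_comp => //.
    exact: measurableT_comp.
  apply: measurable_rV_add => //; apply: measurable_rV_opp.
  exact: measurableT_comp.
- by move=> p; rewrite mule_ge0.
rewrite [RHS](fubini_tonelli (fun p : 'rV[R]_d * 'rV[R]_d => (\1_B (f p.1))%:E * (\1_A (p.2 + f p.1)%R)%:E))/=; last 2 first.
- apply: emeasurable_funM; apply: measurable_indic_comp => //.
    exact: measurableT_comp.
  by apply: measurable_rV_add => //; exact: measurableT_comp.
- by move=> p; rewrite mule_ge0.
apply: eq_integral => y _; have [w fw] := f_surj y.
rewrite -(ge0_integral_volumeD w)//; last first.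
  apply: emeasurable_funM; apply: measurable_indic_comp => //.
  by apply: measurable_rV_add => //; exact: measurable_cst.
apply: eq_integral => x _; rewrite fD fw muleC; congr (_ * _).
  rewrite opprD addrCA subrr addr0 !indicE; congr (_%:R)%:E.
  congr (nat_of_bool _); rewrite -fN; apply/idP/idP => /set_mem h; apply/mem_set.
    by apply: BN; rewrite -fN.
  by apply: BN; rewrite fN opprK.
by rewrite addrC.
Qed.

Definition cube (r : R) : set 'rV[R]_d := [set x | forall i, (`|x ord0 i| <= r)%R].

Lemma measurable_cube r : measurable (cube r).
Proof.
have -> : cube r =
    \bigcap_(i in [set` (enum 'I_d)]) [set y | (`|y ord0 i| <= r)%R].
  apply/seteqP; split => [y yr i _|y yr i]; first exact: yr.
  by apply: yr => /=; rewrite mem_enum.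
apply: fin_bigcap_measurable => // i _.
rewrite [X in measurable X](_ : _ = (fun y : 'rV[R]_d => y ord0 i) @^-1` `[(- r)%R, r]%classic).
  exact: measurable_preimage (measurable_coord i) (measurable_itv _).
by apply/seteqP; split => y; rewrite /= in_itv/= ler_norml.
Qed.

End linear_images.

Section volume_scaling.
Context {R : realType}.
Local Open Scope ereal_scope.
Local Notation leb := (@lebesgue_measure R).

Lemma cons_rV_head n (s : R) (y : 'rV[R]_n) : cons_rV (s, y) ord0 ord0 = s.
Proof.
rewrite (_ : ord0 = @lshift 1 n ord0); last exact/val_inj.
by rewrite [LHS](row_mxEl s%:M y) mxE eqxx mulr1n.
Qed.

Lemma cons_rV_tail n (s : R) (y : 'rV[R]_n) i :
  cons_rV (s, y) ord0 (@rshift 1 n i) = y ord0 i.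
Proof. by rewrite [LHS](row_mxEr s%:M y). Qed.

Lemma volume_cube n (r : R) : (0 <= r)%R ->
  volume (@cube R n r) = ((2 * r) ^+ n)%:E.
Proof.
move=> r0; elim: n => [|n ih].
  rewrite expr0 /volume/= diracE mem_set//= => i; by have := ltn_ord i.
rewrite /= /pushforward (_ : _ @^-1` _ = `[(- r)%R, r]%classic `*` @cube R n r).
  rewrite product_measure1E//; last exact: measurable_cube.
  have len : leb `[(- r)%R, r]%classic = (2 * r)%:E.
    rewrite lebesgue_measure_itv/= lte_fin.
    case: ltP => [_|rr]; first by rewrite -EFinB; congr EFin; ring.
    have -> : r = 0%R by lra.
    by rewrite mulr0.
  by rewrite exprS EFinM -len -ih.
apply/seteqP; split => -[s y] /=.
  move=> h; split.
    by rewrite in_itv/= -ler_norml; have := h ord0; rewrite cons_rV_head.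
  by move=> i; have := h (@rshift 1 n i); rewrite cons_rV_tail.
rewrite in_itv/= -ler_norml => -[sr yr] i.
have [j ->|j ->] := @split_ordP 1 n i; last by rewrite cons_rV_tail.
rewrite (_ : lshift n j = ord0) ?cons_rV_head//.
by apply/val_inj; rewrite (ord1 j).
Qed.

Context {d : nat}.

(** The factor in [volume_additive_image] is read off on a cube. *)
Lemma volume_scale (r : R) (A : set 'rV[R]_d) : (0 < r)%R -> measurable A ->
  volume ((fun x => r *: x)%R @^-1` A) = (r ^- d)%:E * volume A.
Proof.
move=> r0 mA.
have := @volume_additive_image R d (fun x => r *: x)%R A (cube r).
have -> : (fun x => r *: x)%R @^-1` @cube R d r = cube 1.
  apply/seteqP; split => x h i; have := h i; rewrite mxE normrM gtr0_norm//.
    by rewrite ger_pMr.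
  by move=> ?; rewrite ger_pMr.
rewrite !volume_cube ?(ltW r0)// mulr1 => h.
have r2 : ((2 * r) ^+ d != 0)%R by rewrite expf_neq0// mulf_neq0// gt_eqF.
have {h} h : volume ((fun x => r *: x)%R @^-1` A) * ((2 * r) ^+ d)%:E =
    (2 ^+ d)%:E * volume A.
  apply: h => //.
  - by apply: measurable_rV_scale => //; exact: measurable_cst.
  - by move=> x y; rewrite scalerDr.
  - by move=> y; exists (r^-1 *: y)%R; rewrite scalerA divff ?gt_eqF// scale1r.
  - exact: measurable_cube.
  - by move=> x xr i; have := xr i; rewrite mxE normrN.
have : volume ((fun x => r *: x)%R @^-1` A) * ((2 * r) ^+ d)%:E *
    ((2 * r) ^- d)%:E = (2 ^+ d)%:E * volume A * ((2 * r) ^- d)%:E by rewrite h.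
rewrite -muleA -EFinM divff// mule1 => ->.
rewrite muleC muleA -EFinM; congr (_%:E * _).
by rewrite exprMn invfM mulrAC mulVf ?mul1r// expf_neq0// pnatr_eq0.
Qed.

Lemma ge0_integral_scale (r : R) (D : set 'rV[R]_d) (f : 'rV[R]_d -> \bar R) :
  (0 < r)%R -> measurable D -> measurable_fun D f ->
  (forall x, D x -> 0 <= f x) ->
  \int[volume]_(x in (fun x => r *: x)%R @^-1` D) f (r *: x)%R =
  (r ^- d)%:E * \int[volume]_(x in D) f x.
Proof.
move=> r0 mD mf f0.
have rd0 : (0 <= r ^- d)%R by rewrite invr_ge0 exprn_ge0// ltW.
apply: (@ge0_integral_change _ _ _ _ _ (@volume R d) (@volume R d) _ (NngNum rd0)) => //.
  by apply: measurable_rV_scale => //; exact: measurable_cst.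
by move=> A mA; exact: volume_scale.
Qed.

Lemma preimage_scale_eball (r s : R) : (0 < r)%R ->
  (fun x : 'rV[R]_d => r *: x)%R @^-1` eball (r * s) = eball s.
Proof.
move=> r0; apply/seteqP; split => x; rewrite /eball /= enormZ gtr0_norm//.
  by rewrite ler_pM2l.
by rewrite ler_pM2l.
Qed.

Lemma volume_eball_fin_gt0 (r : R) : (0 < r)%R ->
  0 < volume (@eball R d r) < +oo.
Proof.
move=> r0; apply/andP; split.
  have e0 : (0 < r / d.+1%:R)%R by rewrite divr_gt0.
  apply: (@lt_le_trans _ _ (volume (@cube R d (r / d.+1%:R)))).
    by rewrite volume_cube ?(ltW e0)// lte_fin exprn_gt0// mulr_gt0.
  apply: le_measure; rewrite ?inE; [exact: measurable_cube|exact: measurable_eball|].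
  move=> x xr; rewrite /eball /=.
  apply: le_trans (enorm_le_coord (ltW e0) xr) _.
  by rewrite mulrCA ger_pMr// ler_pdivrMr// mul1r ler_nat.
apply: (@le_lt_trans _ _ (volume (@cube R d r))).
  apply: le_measure; rewrite ?inE; [exact: measurable_eball|exact: measurable_cube|].
  by move=> x xr i; apply: le_trans (coord_le_enorm x i) xr.
by rewrite volume_cube ?ltry// ltW.
Qed.

Lemma volume_eball_fin_num (r : R) : (0 <= r)%R -> volume (@eball R d r) \is a fin_num.
Proof.
move=> r0; rewrite ge0_fin_numE//.
apply: (@le_lt_trans _ _ (volume (@eball R d (r + 1)))).
  apply: le_measure; rewrite ?inE; [exact: measurable_eball..|].
  by move=> x xr; rewrite /eball /=; apply: le_trans xr _; rewrite lerDl.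
by have /andP[] : 0 < volume (@eball R d (r + 1)) < +oo
  by apply: volume_eball_fin_gt0; rewrite ltr_wpDl.
Qed.

Lemma kappaE : volume (@eball R d 1) = (@kappa R d)%:E.
Proof. by rewrite fineK// volume_eball_fin_num. Qed.

Lemma kappa_gt0 : (0 < @kappa R d)%R.
Proof.
by rewrite -lte_fin -kappaE; have /andP[] := volume_eball_fin_gt0 (@ltr01 R).
Qed.

Lemma volume_eball (r : R) : (0 < r)%R ->
  volume (@eball R d r) = (r ^+ d * @kappa R d)%:E.
Proof.
move=> r0; have := volume_scale r0 (@measurable_eball R d r).
rewrite -[X in eball X](mulr1 r) preimage_scale_eball// kappaE => h.
rewrite EFinM h mulr1 muleA -EFinM divff ?mul1e//.
by rewrite expf_neq0// gt_eqF.
Qed.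

(** The ball is invariant under [f], so the factor in
    [volume_additive_image] is 1. *)
Lemma volume_isometry (f : 'rV[R]_d -> 'rV[R]_d) (A : set 'rV[R]_d) :
  measurable_fun setT f -> {morph f : x y / (x + y)%R} -> involutive f ->
  (forall x, enorm (f x) = enorm x) -> measurable A ->
  volume (f @^-1` A) = volume A.
Proof.
move=> mf fD fK f_iso mA.
have h : volume (f @^-1` A) * volume (@eball R d 1) =
    volume (f @^-1` eball 1) * volume A.
  apply: volume_additive_image => //.
  - by move=> y; exists (f y); rewrite fK.
  - exact: measurable_eball.
  - by move=> x; rewrite /eball /= enormN.
have fB : f @^-1` eball 1 = eball 1.
  by apply/seteqP; split => x; rewrite /eball /= f_iso.
have k0 : @kappa R d != 0%R by rewrite gt_eqF// kappa_gt0.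
rewrite -[LHS]mule1 -(mulfV k0) EFinM muleA -kappaE h fB kappaE.
by rewrite muleAC -EFinM mulfV// mul1e.
Qed.

Lemma ge0_integral_isometry (f : 'rV[R]_d -> 'rV[R]_d) (D : set 'rV[R]_d)
    (g : 'rV[R]_d -> \bar R) :
  measurable_fun setT f -> {morph f : x y / (x + y)%R} -> involutive f ->
  (forall x, enorm (f x) = enorm x) ->
  measurable D -> measurable_fun D g -> (forall x, D x -> 0 <= g x) ->
  \int[volume]_(x in f @^-1` D) g (f x) = \int[volume]_(x in D) g x.
Proof.
move=> mf fD fK f_iso mD mg g0.
rewrite (@ge0_integral_change _ _ _ _ _ (@volume R d) (@volume R d) _ (1%:nng)%R)//.
  by rewrite mul1e.
by move=> A mA; rewrite mul1e; exact: volume_isometry.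
Qed.

End volume_scaling.

(** * Radial integrals *)

Section radial_integral.
Local Open Scope ereal_scope.
Context {R : realType}.

Lemma nneseries_geometric (a z : R) : (0 <= z < 1)%R ->
  \sum_(0 <= k <oo) (a * z ^+ k)%:E = (a / (1 - z))%:E.
Proof.
move=> /andP[z0 z1].
have h : series (geometric a z) @ \oo --> (a * (1 - z)^-1)%R.
  by apply: cvg_geometric_series; rewrite ger0_norm.
rewrite -(cvg_lim _ h)// -EFin_lim; last by apply/cvg_ex; eexists; exact: h.
by apply/congr_lim/funext => n /=; rewrite /series /= -sumEFin.
Qed.

(** The passage to the limit [h -> 0] of [radial_integral]. *)
Lemma ereal_sandwich (x : \bar R) (C K : R) : (0 <= C)%R -> (0 <= K)%R ->
  (forall h, (0 < h)%R -> (C * expR (- (h * K)))%:E <= x) ->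
  (forall h, (0 < h)%R -> x <= (C * expR (h * K))%:E) ->
  x = C%:E.
Proof.
move=> C0 K0 lo up.
have : x \is a fin_num.
  rewrite fin_numE; apply/andP; split; apply/eqP => xE.
    by have := lo 1%R ltr01; rewrite xE leeNy_eq.
  by have := up 1%R ltr01; rewrite xE leye_eq.
move: x lo up => [r lo up _| |]//; congr EFin.
have u0 (e : R) : (0 < e)%R -> exists2 h : R, (0 < h)%R & (h * K <= e)%R.
  move=> e0; exists (e / (K + 1))%R; first by rewrite divr_gt0// ltr_wpDl.
  by rewrite mulrAC ler_pdivrMr ?ltr_wpDl// ler_pM2l// lerDl.
have r0 : (0 <= r)%R.
  by have := lo _ ltr01; rewrite lee_fin; apply: le_trans; rewrite mulr_ge0// expR_ge0.
apply/eqP; rewrite eq_le; apply/andP; split; apply/ler_addgt0Pr => e e0.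
  have [h h0 hK] := u0 (e / (r + 1))%R (divr_gt0 e0 (ltr_wpDl r0 ltr01)).
  have := up h h0; rewrite lee_fin => rC.
  have : (r * (1 - h * K) <= C)%R.
    apply: (@le_trans _ _ (r * expR (- (h * K)))%R).
      by rewrite ler_wpM2l// expR_ge1Dx.
    by rewrite expRN ler_pdivrMr ?expR_gt0.
  have : (r * (h * K) <= e)%R.
    apply: (@le_trans _ _ (r * (e / (r + 1)))%R); first by rewrite ler_wpM2l.
    by rewrite mulrCA ger_pMr// ler_pdivrMr ?ltr_wpDl// mul1r lerDl.
  by rewrite mulrBr mulr1; lra.
have [h h0 hK] := u0 (e / (C + 1))%R (divr_gt0 e0 (ltr_wpDl C0 ltr01)).
have := lo h h0; rewrite lee_fin => rC.
have : (C * (1 - h * K) <= r)%R.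
  by apply: le_trans rC; rewrite ler_wpM2l// expR_ge1Dx.
have : (C * (h * K) <= e)%R.
  apply: (@le_trans _ _ (C * (e / (C + 1)))%R); first by rewrite ler_wpM2l.
  by rewrite mulrCA ger_pMr// ler_pdivrMr ?ltr_wpDl// mul1r lerDl.
by rewrite mulrBr mulr1; lra.
Qed.

(* In the applications [g] is the norm, and [w] a weight that is homogeneous of
   degree [p] minus the dimension; [ballE] then holds by scaling. *)
Context {dT} {T : measurableType dT} (mu : {measure set T -> \bar R}).
Variables (g : T -> R) (w : T -> \bar R) (c p tau : R).
Hypothesis mg : measurable_fun setT g.
Hypothesis g0 : forall x, (0 <= g x)%R.
Hypothesis mw : measurable_fun setT w.
Hypothesis w0 : forall x, 0 <= w x.
Hypothesis c0 : (0 <= c)%R.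
Hypothesis p0 : (0 < p)%R.
Hypothesis s0 : (0 < p + tau)%R.
Hypothesis ballE : forall r, (0 < r <= 1)%R ->
  \int[mu]_(x in [set x | (g x <= r)%R]) w x = (c * r `^ p)%:E.

Let mle (r : R) : measurable [set x | (g x <= r)%R].
Proof.
rewrite (_ : [set x | _] = g @^-1` `]-oo, r]%classic).
  exact: measurable_preimage mg (measurable_itv _).
by apply/seteqP; split => x; rewrite /= in_itv.
Qed.

Let mlt (r : R) : measurable [set x | (r < g x)%R].
Proof.
rewrite (_ : [set x | _] = g @^-1` `]r, +oo[%classic).
  exact: measurable_preimage mg (measurable_itv _).
by apply/seteqP; split => x; rewrite /= in_itv/= andbT.
Qed.

Let shell (a b : R) := [set x | (a < g x)%R] `&` [set x | (g x <= b)%R].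

Let mshell a b : measurable (shell a b).
Proof. exact: measurableI. Qed.

Let integral_split (a b : R) (f : T -> \bar R) : (a <= b)%R ->
  measurable_fun setT f -> (forall x, 0 <= f x) ->
  \int[mu]_(x in [set x | (g x <= b)%R]) f x =
  \int[mu]_(x in [set x | (g x <= a)%R]) f x + \int[mu]_(x in shell a b) f x.
Proof.
move=> ab mf f0; rewrite -ge0_integral_setU//.
- congr (integral _ _ _); apply/seteqP; split => x /=.
    by move=> xb; have [xa|xa] := leP (g x) a; [left|right].
  by case=> [xa|[]//]; exact: le_trans ab.
- exact: measurable_funTS.
- by apply/disj_setPS => x [/= xa [/= ax _]]; move: ax; rewrite ltNge xa.
Qed.

Let integral_shell (a b : R) : (0 < a)%R -> (a <= b)%R -> (b <= 1)%R ->
  \int[mu]_(x in shell a b) w x = (c * b `^ p - c * a `^ p)%:E.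
Proof.
move=> a0 ab b1; have := integral_split ab mw w0.
rewrite !ballE ?a0 ?(lt_le_trans a0 ab) ?(le_trans ab b1)//.
by move=> h; rewrite EFinB h [(_ + \int[mu]_(x in _) _)%E]addeC addeK.
Qed.

Let f x := (g x `^ tau)%:E * w x.

Let mf : measurable_fun setT f.
Proof.
apply: emeasurable_funM => //; apply/measurable_EFinP.
exact: measurableT_comp (measurable_powR tau) mg.
Qed.

Let f0 x : 0 <= f x.
Proof. by rewrite mule_ge0// lee_fin powR_ge0. Qed.

Section shells.
Variable h : R.
Hypothesis h0 : (0 < h)%R.
Let rad k : R := expR (- (h * k%:R)).
Let S k := shell (rad k.+1) (rad k).

Let rad_gt0 k : (0 < rad k)%R. Proof. exact: expR_gt0. Qed.
Let radS k : (rad k.+1 <= rad k)%R.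
Proof. by rewrite ler_expR lerN2 ler_pM2l// ler_nat. Qed.
Let rad_le1 k : (rad k <= 1)%R.
Proof. by rewrite expR_le1 oppr_le0 mulr_ge0// ltW. Qed.

Let weight k :
  \int[mu]_(x in S k) w x = (c * (1 - expR (- (h * p))) * expR (- (h * p)) ^+ k)%:E.
Proof.
rewrite integral_shell//; congr EFin; rewrite -!expRM -mulrBr.
rewrite (_ : - (h * k.+1%:R) * p = - (h * p) * k.+1%:R)%R; last by ring.
rewrite (_ : - (h * k%:R) * p = - (h * p) * k%:R)%R; last by ring.
by rewrite !expRM_natr exprS; ring.
Qed.

Let bound k x : S k x ->
  (expR (- (h * `|tau|)) * expR (- (h * tau)) ^+ k <= g x `^ tau <=
   expR (h * `|tau|) * expR (- (h * tau)) ^+ k)%R.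
Proof.
move=> [/= lo up]; have gx0 : (0 < g x)%R by exact: lt_trans lo.
rewrite /powR gt_eqF// -!expRM_natr -!expRD !ler_expR.
have {lo} : (- (h * k.+1%:R) < ln (g x))%R by rewrite -ltr_expR lnK.
have {up} : (ln (g x) <= - (h * k%:R))%R by rewrite -ler_expR lnK.
rewrite -natr1; set l := ln (g x); set n := k%:R => up lo.
have : (`|tau * (l + h * n)| <= h * `|tau|)%R.
  rewrite normrM mulrC ler_wpM2r// ler_norml.
  by apply/andP; split; lra.
rewrite ler_norml => /andP[] A B; apply/andP; split; lra.
Qed.

Let bigcup_S : \bigcup_k S k = shell 0 1.
Proof.
apply/seteqP; split => [x [k _ [/= lo up]]|x [/= x0 x1]].
  by split; [exact: lt_trans lo|exact: le_trans (rad_le1 k)].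
have l0 : (0 <= - ln (g x) / h)%R.
  by rewrite divr_ge0 ?oppr_ge0 ?ln_le0// ltW.
have /andP[] := truncn_itv l0.
rewrite ler_pdivlMr// ltr_pdivrMr// => A B.
exists (Num.trunc (- ln (g x) / h)) => //; split => /=.
  by rewrite -[ltRHS]lnK// ltr_expR; rewrite mulrC ltrNl.
by rewrite -[leLHS]lnK// ler_expR mulrC lerNr.
Qed.

Let trivS : trivIset setT S.
Proof.
apply/trivIsetP => i j _ _ ij.
wlog: i j ij / (i < j)%N => [th|{}ij].
  by case: (ltngtP i j) ij => // ij _; [|rewrite setIC]; apply: th; rewrite ?ltn_eqF// gtn_eqF.
apply/seteqP; split => // x [[/= lo _] [_ /= up]].
suff : (rad j <= rad i.+1)%R by rewrite leNgt (lt_le_trans lo up).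
by rewrite ler_expR lerN2 ler_pM2l// ler_nat.
Qed.

Let ratio_le : ((1 - expR (- (h * p))) / (1 - expR (- (h * (p + tau)))) <=
  p / (p + tau) * expR (h * (p + tau)))%R.
Proof.
have hs0 : (0 < h * (p + tau))%R by rewrite mulr_gt0.
rewrite ler_pdivrMr; last by rewrite subr_gt0 expR_lt1 oppr_lt0.
apply: (@le_trans _ _ (h * p)%R).
  by rewrite lerBlDr -lerBlDl expR_ge1Dx.
have E : (expR (h * (p + tau)) * (1 - expR (- (h * (p + tau)))) =
    expR (h * (p + tau)) - 1)%R by rewrite mulrBr mulr1 -expRD subrr expR0.
rewrite -[leRHS]mulrA E.
apply: (@le_trans _ _ (p / (p + tau) * (h * (p + tau)))%R).
  by rewrite mulrCA -mulrA mulVf ?gt_eqF// mulr1 mulrC.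
rewrite ler_wpM2l//; first by rewrite divr_ge0// ltW.
by rewrite lerBrDr addrC expR_ge1Dx.
Qed.

Let ratio_ge : (p / (p + tau) * expR (- (h * p)) <=
  (1 - expR (- (h * p))) / (1 - expR (- (h * (p + tau)))))%R.
Proof.
have hs0 : (0 < h * (p + tau))%R by rewrite mulr_gt0.
rewrite ler_pdivlMr; last by rewrite subr_gt0 expR_lt1 oppr_lt0.
apply: (@le_trans _ _ (p / (p + tau) * expR (- (h * p)) * (h * (p + tau)))%R).
  rewrite ler_wpM2l//; first by rewrite mulr_ge0 ?expR_ge0// divr_ge0// ltW.
  by rewrite lerBlDr -lerBlDl expR_ge1Dx.
rewrite (_ : _ * _ = h * p * expR (- (h * p)))%R; last by field; rewrite gt_eqF.
rewrite lerBrDr -[X in (_ + X)%R]mul1r -mulrDl addrC.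
by rewrite expRN ler_pdivrMr ?expR_gt0// mul1r expR_ge1Dx.
Qed.

Let C := (c * p / (p + tau))%R.

(* On the shell number [k] the weight and the bound on [g `^ tau] are both
   geometric in [k]. *)
Let geometric_ratio (m : R) :
  \sum_(0 <= k <oo)
    (m * expR (- (h * tau)) ^+ k *
     (c * (1 - expR (- (h * p))) * expR (- (h * p)) ^+ k))%:E =
  (m * (c * ((1 - expR (- (h * p))) / (1 - expR (- (h * (p + tau)))))))%:E.
Proof.
rewrite -[RHS](_ : (m * (c * (1 - expR (- (h * p)))) /
    (1 - expR (- (h * (p + tau)))))%:E = _); last by rewrite !mulrA.
rewrite -nneseries_geometric; last first.
  by rewrite expR_ge0 expR_lt1 oppr_lt0 mulr_gt0.
apply: eq_eseriesr => k _; congr EFin.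
have -> : (- (h * (p + tau)) = - (h * tau) + - (h * p))%R by ring.
by rewrite expRD exprMn; ring.
Qed.

Lemma radial_integral_shells :
  (C * expR (- (h * (`|tau| + p + (p + tau)))))%:E <=
    \int[mu]_(x in shell 0 1) f x <=
  (C * expR (h * (`|tau| + p + (p + tau))))%:E.
Proof.
rewrite -bigcup_S ge0_integral_bigcup//; last 2 first.
- by move=> k; exact: mshell.
- exact: measurable_funTS.
have cE m : (c * (p / (p + tau) * m) = C * m)%R by rewrite /C; ring.
have C0 : (0 <= C)%R by rewrite /C divr_ge0 ?mulr_ge0// ltW.
apply/andP; split.
  apply: (@le_trans _ _ (expR (- (h * `|tau|)) * (c * (p / (p + tau) * expR (- (h * p)))))%:E).
    rewrite lee_fin cE mulrCA -expRD ler_wpM2l// ler_expR.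
    by have := mulr_gt0 h0 s0; lra.
  apply: (@le_trans _ _ (expR (- (h * `|tau|)) * (c * ((1 - expR (- (h * p))) /
      (1 - expR (- (h * (p + tau)))))))%:E).
    by rewrite lee_fin ler_wpM2l ?expR_ge0// ler_wpM2l.
  rewrite -geometric_ratio; apply: lee_nneseries => [k _ _|k _].
    by rewrite lee_fin !mulr_ge0 ?exprn_ge0 ?expR_ge0// subr_ge0 expR_le1 oppr_le0 mulr_ge0 ?ltW.
  rewrite EFinM -weight -ge0_integralZl//; last 2 first.
  - exact: mshell.
  - exact: measurable_funTS.
  apply: ge0_le_integral => //; first exact: mshell.
  - by move=> x _; rewrite mule_ge0// lee_fin mulr_ge0 ?exprn_ge0 ?expR_ge0.
  - by apply: measurable_funTS; exact: measurable_funeM.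
  - exact: measurable_funTS.
  - by move=> x /bound/andP[xk _]; rewrite lee_wpmul2r// lee_fin.
apply: (@le_trans _ _ (expR (h * `|tau|) * (c * (p / (p + tau) * expR (h * (p + tau)))))%:E); last first.
  rewrite lee_fin cE mulrCA -expRD ler_wpM2l// ler_expR.
  by have := mulr_gt0 h0 p0; lra.
apply: (@le_trans _ _ (expR (h * `|tau|) * (c * ((1 - expR (- (h * p))) /
      (1 - expR (- (h * (p + tau)))))))%:E); last first.
  by rewrite lee_fin ler_wpM2l ?expR_ge0// ler_wpM2l.
rewrite -geometric_ratio; apply: lee_nneseries => [k _ _|k _].
  by apply: integral_ge0 => x _; exact: f0.
rewrite EFinM -weight -ge0_integralZl//; last 2 first.
- exact: mshell.
- exact: measurable_funTS.
apply: ge0_le_integral => //; first exact: mshell.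
- exact: measurable_funTS.
- by apply: measurable_funTS; exact: measurable_funeM.
- by move=> x /bound/andP[_ xk]; rewrite lee_wpmul2r// lee_fin.
Qed.

End shells.

(** The set where [g] vanishes has to be treated apart from the shells. *)
Let weight_center : \int[mu]_(x in [set x | (g x <= 0)%R]) w x = 0.
Proof.
apply/eqP; rewrite eq_le integral_ge0// andbT.
apply/lee_addgt0Pr => e e0; rewrite add0e.
have [r /andP[r0 r1] re] : exists2 r : R, (0 < r <= 1)%R & (c * r `^ p <= e)%R.
  have e1 : (0 < e / (c + 1))%R by rewrite divr_gt0// ltr_wpDl.
  have := powR_cvg0 p0; move/cvgrPdist_le => /(_ _ e1) cv.
  near ((0 : R)^'+)%R => r; exists r.
    apply/andP; split; first by near: r; exact: nbhs_right_gt.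
    by near: r; exact: nbhs_right_le.
  have : (`|0 - r `^ p| <= e / (c + 1))%R by near: r; exact: cv.
  rewrite sub0r normrN ger0_norm ?powR_ge0// => h.
  apply: (@le_trans _ _ (c * (e / (c + 1)))%R); first by rewrite ler_wpM2l.
  by rewrite mulrCA ger_pMr// ler_pdivrMr ?ltr_wpDl// mul1r lerDl.
apply: (@le_trans _ _ (c * r `^ p)%:E); last by rewrite lee_fin.
rewrite -ballE ?r0//; apply: ge0_subset_integral => //.
  exact: measurable_funTS.
by move=> x /= /le_trans; apply; exact: ltW.
Unshelve. all: by end_near. Qed.

(** Cut the ball into the shells [exp (- h (k + 1)) < g <= exp (- h k)]: there
    [g `^ tau] is constant up to a factor [exp (h |tau|)], so that the integral
    is a geometric series up to that factor; then let [h] tend to 0. *)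
Lemma radial_integral :
  \int[mu]_(x in [set x | (g x <= 1)%R]) ((g x `^ tau)%:E * w x) =
  (c * p / (p + tau))%:E.
Proof.
rewrite -[LHS]/(\int[mu]_(x in [set x | (g x <= 1)%R]) f x).
rewrite (integral_split ler01 mf f0).
rewrite (_ : \int[mu]_(x in [set x | _]) f x = 0) ?add0e; last first.
  transitivity (\int[mu]_(x in [set x | (g x <= 0)%R]) ((0 `^ tau)%:E * w x)).
    apply: eq_integral => x /set_mem /= gx; congr (_ * _).
    have -> : g x = 0%R by apply/eqP; rewrite eq_le gx g0.
    by [].
  rewrite ge0_integralZl ?weight_center ?mule0 ?lee_fin ?powR_ge0//.
  exact: measurable_funTS.
apply: (@ereal_sandwich _ _ (`|tau| + p + (p + tau))%R).
- by rewrite divr_ge0 ?mulr_ge0// ltW.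
- by rewrite addr_ge0 ?(ltW s0)// addr_ge0// ltW.
- by move=> h h0; have /andP[] := radial_integral_shells h0.
- by move=> h h0; have /andP[] := radial_integral_shells h0.
Qed.

End radial_integral.

(** * Moments of the Euclidean ball *)

Section ball_moments.
Local Open Scope ereal_scope.
Context {R : realType}.
Local Notation leb := (@lebesgue_measure R).

Lemma integral_mul_indic {dT} {T : measurableType dT}
    (mu : {measure set T -> \bar R}) (D : set T) (f : T -> \bar R) :
  \int[mu]_(x in D) f x = \int[mu]_x ((\1_D x)%:E * f x).
Proof.
rewrite integral_mkcond epatch_indic; apply: eq_integral => x _.
by rewrite muleC.
Qed.

Lemma measurable_enorm_powR {d} (tau : R) :
  measurable_fun setT (fun y : 'rV[R]_d => (enorm y `^ tau)%:E).
Proof.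
apply/measurable_EFinP.
exact: measurableT_comp (measurable_powR tau) measurable_enorm.
Qed.

Lemma integral_enorm_powR d (tau : R) : (0 < d)%N -> (- d%:R < tau)%R ->
  \int[volume]_(y in @eball R d 1) (enorm y `^ tau)%:E =
  (d%:R * @kappa R d / (d%:R + tau))%:E.
Proof.
move=> d0 dtau.
have := @radial_integral R _ _ (@volume R d) (@enorm R d) (cst 1) (@kappa R d)
  d%:R tau measurable_enorm enorm_ge0.
rewrite (mulrC d%:R) => <- //.
- by apply: eq_integral => x _; rewrite mule1.
- by rewrite ltW// kappa_gt0.
- by rewrite ltr0n.
- by rewrite -ltrBlDl sub0r.
- move=> r /andP[r0 r1]; rewrite integral_cst ?mul1e; last first.
    exact: (@measurable_eball _ _ r).
  by rewrite powR_mulrn ?(ltW r0)// mulrC -volume_eball.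
Qed.

Lemma integral_enorm_powR_eball d (tau r : R) :
  (0 < d)%N -> (- d%:R < tau)%R -> (0 < r)%R ->
  \int[volume]_(y in @eball R d r) (enorm y `^ tau)%:E =
  (r `^ (tau + d%:R) * (d%:R * @kappa R d / (d%:R + tau)))%:E.
Proof.
move=> d0 dtau r0.
have h : \int[volume]_(x in @eball R d 1) (enorm (r *: x)%R `^ tau)%:E =
    (r ^- d)%:E * \int[volume]_(x in @eball R d r) (enorm x `^ tau)%:E.
  rewrite -(preimage_scale_eball 1 r0) mulr1.
  apply: (@ge0_integral_scale R d r _ (fun x => (enorm x `^ tau)%:E)) => //.
  - exact: measurable_eball.
  - exact: measurable_funTS (measurable_enorm_powR tau).
  - by move=> x _; rewrite lee_fin powR_ge0.
rewrite powRD; last by rewrite (gt_eqF r0) implybT.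
rewrite powR_mulrn ?(ltW r0)// mulrAC EFinM.
transitivity ((r ^+ d)%:E *
    \int[volume]_(x in @eball R d 1) (enorm (r *: x)%R `^ tau)%:E).
  by rewrite h muleA -EFinM divff ?mul1e// expf_neq0// gt_eqF.
rewrite [RHS]muleC; congr (_ * _).
under eq_integral do rewrite enormZ gtr0_norm// powRM ?(ltW r0) ?enorm_ge0// EFinM.
rewrite ge0_integralZl ?lee_fin ?powR_ge0//.
- by rewrite integral_enorm_powR// -EFinM.
- exact: measurable_eball.
- exact: measurable_funTS (measurable_enorm_powR tau).
- by move=> x _; rewrite lee_fin powR_ge0.
Qed.

Lemma integral_itv_id (a : R) : (0 <= a)%R ->
  \int[leb]_(s in `[0%R, a]) s%:E = (a ^+ 2 / 2)%:E.
Proof.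
rewrite le_eqVlt => /predU1P[<-|a0].
  by rewrite set_itv1 integral_set1 expr0n /= mul0r.
rewrite (@continuous_FTC2 _ id (fun s => s ^+ 2 / 2)%R)//.
- by rewrite expr0n /= mul0r sube0.
- by apply: continuous_subspaceT => x; exact: cvg_id.
- split.
  + by move=> x _; apply: derivableM => //; exact: exprn_derivable.
  + apply: cvg_at_right_filter; apply: cvgM; last exact: cvg_cst.
    exact: exprn_continuous.
  + apply: cvg_at_left_filter; apply: cvgM; last exact: cvg_cst.
    exact: exprn_continuous.
- move=> x _; rewrite derive1Mr; last exact: exprn_derivable.
  rewrite exp_derive1 expr1; change (2 * x / 2 = x)%R.
  by rewrite mulrAC divff ?mul1r// pnatr_eq0.
Qed.

Lemma integral_enorm_sqr d :
  \int[volume]_(y in @eball R d 1) (enorm y ^+ 2)%:E =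
  (d%:R * @kappa R d / (d%:R + 2))%:E.
Proof.
case: d => [|d].
  rewrite mul0r mul0r integral0_eq// => y _.
  by rewrite (thinmx0 y) enorm0 expr0n.
rewrite -integral_enorm_powR//; last first.
  by rewrite (@lt_trans _ _ 0%R)// oppr_lt0.
by apply: eq_integral => y _; rewrite powR_mulrn// enorm_ge0.
Qed.

(** [(1 - |y|^2) / 2] is the contribution of the vertical section at [y] to
    [integral_height]. *)
Lemma integral_compl_enorm_sqr d :
  \int[volume]_(y in @eball R d 1) ((1 - enorm y ^+ 2) / 2)%:E =
  (@kappa R d / (d%:R + 2))%:E.
Proof.
have msq : measurable_fun setT (fun y : 'rV[R]_d => enorm y ^+ 2)%R.
  by apply: measurable_funX; exact: measurable_enorm.
set I := (LHS).
have : I + \int[volume]_(y in @eball R d 1) (2^-1 * enorm y ^+ 2)%:E = (@kappa R d / 2)%:E.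
  rewrite -ge0_integralD//=.
  - transitivity (\int[volume]_(y in @eball R d 1) (2^-1)%:E).
      by apply: eq_integral => y _; rewrite -EFinD; congr EFin; lra.
    transitivity ((2^-1)%:E * volume (@eball R d 1)).
      exact: integral_cst (measurable_eball 1) _.
    by rewrite muleC kappaE -EFinM.
  - exact: measurable_eball.
  - move=> y y1; rewrite lee_fin divr_ge0// subr_ge0.
    by rewrite exprn_ile1// enorm_ge0.
  - apply: measurable_funTS; apply/measurable_EFinP; apply: measurable_funM => //.
    by apply: measurable_funB.
  - by move=> y _; rewrite lee_fin mulr_ge0// sqr_ge0.
  - apply: measurable_funTS; apply/measurable_EFinP; exact: measurable_funM.
under eq_integral do rewrite EFinM.
rewrite ge0_integralZl//; last 3 first.
- exact: measurable_eball.
- by apply: measurable_funTS; apply/measurable_EFinP.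
- by move=> y _; rewrite lee_fin sqr_ge0.
rewrite integral_enorm_sqr -EFinM => /eqP.
rewrite eq_sym -sube_eq ?fin_num_adde_defl// => /eqP <-.
rewrite -EFinB; congr EFin; field.
by rewrite -(natrD _ d 2) pnatr_eq0 addn2.
Qed.

Lemma enorm_cons_rV d (s : R) (y : 'rV[R]_d) :
  (enorm (cons_rV (s, y)) ^+ 2 = s ^+ 2 + enorm y ^+ 2)%R.
Proof.
rewrite !sqr_enorm /dotp big_ord_recl cons_rV_head -expr2; congr (_ + _)%R.
apply: eq_bigr => i _; rewrite (_ : lift ord0 i = @rshift 1 d i); last exact/val_inj.
by rewrite cons_rV_tail.
Qed.

Definition height d (y : 'rV[R]_d.+1) : R := Num.max (y ord0 ord0) 0%R.

Lemma measurable_height d : measurable_fun setT (@height d).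
Proof. by apply: measurable_maxr => //; exact: measurable_coord. Qed.

Lemma height_ge0 d (y : 'rV[R]_d.+1) : (0 <= height y)%R.
Proof. by rewrite /height le_max lexx orbT. Qed.

Lemma heightZ d (r : R) (y : 'rV[R]_d.+1) : (0 < r)%R ->
  (height (r *: y) = r * height y)%R.
Proof. by move=> r0; rewrite /height mxE maxr_pMr ?ltW// mulr0. Qed.

(** By Tonelli: the points of the ball above [y] form the segment
    [0 <= s <= sqrt (1 - |y|^2)], over which [s] integrates to
    [(1 - |y|^2) / 2]. *)
Lemma integral_height d :
  \int[volume]_(y in @eball R d.+1 1) (height y)%:E = (@kappa R d / (d%:R + 2))%:E.
Proof.
pose f (y : 'rV[R]_d.+1) := (\1_(eball 1) y)%:E * (height y)%:E.
have mf : measurable_fun setT f.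
  apply: emeasurable_funM; last by apply/measurable_EFinP; exact: measurable_height.
  by apply/measurable_EFinP/measurable_indic; exact: measurable_eball.
have f0 y : 0 <= f y by rewrite mule_ge0// lee_fin height_ge0.
rewrite integral_mul_indic (ge0_integral_volumeS mf f0).
rewrite (fubini_tonelli (f \o @cons_rV R d)); last 2 first.
- exact: measurableT_comp mf (@measurable_cons_rV R d).
- by move=> p; exact: f0.
rewrite -integral_compl_enorm_sqr [RHS]integral_mul_indic.
apply: eq_integral => y _ /=.
have fE s : f (cons_rV (s, y)) =
    (\1_(@eball R d 1) y)%:E * ((\1_`[0%R, Num.sqrt (1 - enorm y ^+ 2)] s)%:E * s%:E).
  rewrite /f /height cons_rV_head; have [s0|s0] := ltP s 0%R.
    rewrite mule0 [\1_`[_, _] s]indicE memNset ?mul0e ?mule0//=.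
    by rewrite in_itv/= leNgt s0.
  rewrite muleA; congr (_ * _); rewrite !indicE -EFinM -natrM mulnb.
  congr (_%:R)%:E; congr nat_of_bool.
  apply/idP/andP => [/set_mem|[/set_mem y1 /set_mem]].
    rewrite /eball /= -(@expr_le1 _ 2)// ?enorm_ge0// enorm_cons_rV => sy.
    have y1 : (enorm y ^+ 2 <= 1)%R by have := sqr_ge0 s; lra.
    split; apply/mem_set; rewrite /eball /=.
      by move: y1; rewrite expr_le1// enorm_ge0.
    rewrite in_itv/= s0 -(ler_pXn2r (n := 2))// ?nnegrE ?sqrtr_ge0//.
    by rewrite (@sqr_sqrtr _ (1 - enorm y ^+ 2)%R) ?subr_ge0//; lra.
  rewrite /= in_itv/= => /andP[_ sa]; apply/mem_set; rewrite /eball /=.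
  rewrite -(@expr_le1 _ 2)// ?enorm_ge0// enorm_cons_rV.
  have y2 : (enorm y ^+ 2 <= 1)%R by rewrite expr_le1// enorm_ge0.
  have : (s ^+ 2 <= Num.sqrt (1 - enorm y ^+ 2) ^+ 2)%R.
    by rewrite ler_pXn2r ?nnegrE ?sqrtr_ge0.
  by rewrite (@sqr_sqrtr _ (1 - enorm y ^+ 2)%R) ?subr_ge0// => ?; lra.
transitivity (\int[leb]_s ((\1_(@eball R d 1) y)%:E *
   ((\1_`[0%R, Num.sqrt (1 - enorm y ^+ 2)] s)%:E * s%:E))).
  by apply: eq_integral => s _; exact: fE.
have i0 (s : R) :
    0 <= (\1_`[0%R, Num.sqrt (1 - enorm y ^+ 2)] s)%:E * s%:E.
  rewrite indicE; case: (boolP (s \in _)) => [|_]; last by rewrite mul0e.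
  by rewrite mul1e lee_fin inE/= in_itv/= => /andP[].
rewrite ge0_integralZl//; last first.
  apply: emeasurable_funM; apply/measurable_EFinP.
    by apply/measurable_indicP; exact: measurable_itv.
  exact: measurable_id.
rewrite -integral_mul_indic integral_itv_id ?sqrtr_ge0// !indicE.
case: (boolP (y \in _)) => [/set_mem y1|_]; last by rewrite !mul0e.
by rewrite (@sqr_sqrtr _ (1 - enorm y ^+ 2)%R)// subr_ge0 expr_le1// enorm_ge0.
Qed.

Lemma height_radial d (r : R) : (0 < r)%R ->
  \int[volume]_(y in @eball R d.+1 r) (height y)%:E =
  (@kappa R d / (d%:R + 2) * r `^ d.+2%:R)%:E.
Proof.
move=> r0.
have h : \int[volume]_(x in @eball R d.+1 1) (height (r *: x)%R)%:E =
    (r ^- d.+1)%:E * \int[volume]_(x in @eball R d.+1 r) (height x)%:E.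
  rewrite -(preimage_scale_eball 1 r0) mulr1.
  apply: (@ge0_integral_scale R d.+1 r _ (fun x => (height x)%:E)) => //.
  - exact: measurable_eball.
  - by apply: measurable_funTS; apply/measurable_EFinP; exact: measurable_height.
  - by move=> x _; rewrite lee_fin height_ge0.
have rd : (r ^+ d.+1 != 0)%R by rewrite expf_neq0// gt_eqF.
transitivity ((r ^+ d.+1)%:E *
    \int[volume]_(x in @eball R d.+1 1) (height (r *: x)%R)%:E).
  by rewrite h muleA -EFinM divff ?mul1e.
under eq_integral do rewrite heightZ// EFinM.
rewrite ge0_integralZl ?lee_fin ?(ltW r0)//.
- rewrite integral_height -!EFinM; congr EFin.
  by rewrite powR_mulrn ?(ltW r0)// [in RHS]exprSr; ring.
- exact: measurable_eball.
- by apply: measurable_funTS; apply/measurable_EFinP; exact: measurable_height.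
- by move=> x _; rewrite lee_fin height_ge0.
Qed.

(** [height] is homogeneous of degree 1, so [radial_integral] applies with the
    exponent [d + 2] in dimension [d + 1]. *)
Lemma integral_enorm_powR_height d (tau : R) : (- d.+1%:R < tau)%R ->
  \int[volume]_(y in @eball R d.+1 1) ((enorm y `^ tau)%:E * (height y)%:E) =
  (@kappa R d / (tau + d.+1%:R + 1))%:E.
Proof.
move=> dtau.
have := @radial_integral R _ _ (@volume R d.+1) (@enorm R d.+1)
  (fun y => (height y)%:E) (@kappa R d / (d%:R + 2))%R d.+2%:R tau
  measurable_enorm (@enorm_ge0 R d.+1).
have -> : (@kappa R d / (tau + d.+1%:R + 1) =
    @kappa R d / (d%:R + 2) * d.+2%:R / (d.+2%:R + tau))%R.
  have d2 : (d%:R + 2 = d.+2%:R :> R)%R by rewrite -(natrD _ d 2) addn2.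
  rewrite d2 divfK ?pnatr_eq0//; congr (_ / _)%R.
  by rewrite -[d.+2%:R]natr1; ring.
apply.
- by apply/measurable_EFinP; exact: measurable_height.
- by move=> x; rewrite lee_fin height_ge0.
- by rewrite divr_ge0// ?addr_ge0// ltW// kappa_gt0.
- by rewrite ltr0n.
- move: dtau; rewrite -[d.+2%:R]natr1; lra.
- by move=> r /andP[r0 _]; exact: height_radial.
Qed.

End ball_moments.

(** * The Brunn-Minkowski inequality *)

Section brunn_minkowski.
Local Open Scope ereal_scope.
Context {R : realType}.
Local Notation leb := (@lebesgue_measure R).

(** Translate [A] by a point of [B] close to [inf B] and [B] by a point of [A]
    close to [sup A]: the two translates lie in [C] and almost do not
    overlap. *)
Lemma lebesgue_sumset (A B C : set (measurableTypeR R)) (M : R) :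
  measurable A -> measurable B -> measurable C -> A !=set0 -> B !=set0 ->
  (forall a, A a -> (`|a| <= M)%R) -> (forall b, B b -> (`|b| <= M)%R) ->
  (forall a b, A a -> B b -> C (a + b)%R) ->
  leb A + leb B <= leb C.
Proof.
move=> mA mB mC A0 B0 AM BM ABC.
have hA : has_sup A.
  by split => //; exists M => a /AM; rewrite ler_norml => /andP[].
have hB : has_inf B.
  by split => //; exists (- M)%R => a /BM; rewrite ler_norml => /andP[].
apply/lee_addgt0Pr => e e0.
have e2 : (0 < e / 2)%R by rewrite divr_gt0.
have [a0 Aa0 a0e] := sup_adherent e2 hA.
have [b0 Bb0 b0e] := inf_adherent e2 hB.
pose A' := (fun x => x + - b0)%R @^-1` A.
pose B' := (fun x => x + - a0)%R @^-1` B.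
pose I := `[(a0 + inf B)%R, (sup A + b0)%R]%classic.
have mtr v (D : set (measurableTypeR R)) : measurable D ->
    measurable ((fun x => x + v)%R @^-1` D).
  by apply: measurable_preimage; exact: measurable_funD.
have mA' : measurable A' by exact: mtr.
have mB' : measurable B' by exact: mtr.
have mI : measurable I by exact: measurable_itv.
have lenI : leb I <= e%:E.
  rewrite lebesgue_measure_itv/= lte_fin; case: ifPn => _.
    by rewrite -EFinB lee_fin; lra.
  by rewrite lee_fin ltW.
rewrite -(lebesgue_measureD (- b0) mA) -(lebesgue_measureD (- a0) mB).
rewrite -/A' -/B'.
have A'I : leb A' <= leb (A' `\` I) + leb I.
  have := measureU2 leb (measurableD mA' mI) mI => h.
  apply: le_trans h; apply: le_measure; rewrite ?inE//.
    by apply: measurableU => //; exact: measurableD.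
  by move=> x A'x; have [Ix|Ix] := pselect (I x); [right|left].
apply: (@le_trans _ _ (leb (A' `\` I) + leb I + leb B')).
  by rewrite leeD2r.
rewrite addeAC; apply: leeD => //.
rewrite -measureU//=; last 2 first.
- exact: measurableD.
- apply/seteqP; split => // x [[A'x nIx] B'x]; apply: nIx.
  rewrite /I /= in_itv /=; apply/andP; split.
    rewrite addrC -lerBrDr; exact: (ge_inf hB.2 B'x).
  by rewrite -lerBlDr; exact: (ub_le_sup hA.2 A'x).
apply: le_measure; rewrite ?inE//.
  by apply: measurableU => //; exact: measurableD.
move=> x [[A'x _]|B'x].
  by rewrite -(subrK b0 x); exact: ABC.
by rewrite -(subrKC a0 x); exact: ABC.
Qed.

Lemma ge0_layer_cake (h : measurableTypeR R -> R) :
  measurable_fun setT h -> (forall s, (0 <= h s)%R) ->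
  \int[leb]_s (h s)%:E =
  \int[leb]_(u in `[0%R, +oo[) leb [set s | (u < h s)%R].
Proof.
move=> mh h0.
pose D := [set p : measurableTypeR R * measurableTypeR R |
  (0 <= p.2)%R && (p.2 < h p.1)%R].
have mD : measurable D.
  pose t1 (p : measurableTypeR R * measurableTypeR R) := (0 <= p.2)%R.
  pose t2 (p : measurableTypeR R * measurableTypeR R) := (p.2 < h p.1)%R.
  have -> : D = t1 @^-1` [set true] `&` t2 @^-1` [set true].
    by apply/seteqP; split => p; rewrite /D /= => /andP.
  have mt1 : measurable_fun setT t1 by exact: measurable_fun_ler.
  have mt2 : measurable_fun setT t2.
    apply: measurable_fun_ltr => //; exact: measurableT_comp mh measurable_fst.
  by apply: measurableI; apply: measurable_preimage.
transitivity (\int[leb]_s \int[leb]_u (\1_D (s, u))%:E).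
  apply: eq_integral => s _.
  transitivity (\int[leb]_u (\1_`[0%R, h s[ u)%:E).
    rewrite integral_indic//= setIT lebesgue_measure_itv/= lte_fin.
    by case: ltP => [_|hs]; [rewrite sube0|congr EFin; apply/eqP; rewrite eq_le hs h0].
  apply: eq_integral => u _; rewrite !indicE; congr (_%:R)%:E; congr nat_of_bool.
rewrite (fubini_tonelli (fun p => (\1_D p)%:E))//; last first.
  exact/measurable_EFinP/measurable_indic.
rewrite [RHS]integral_mkcond; apply: eq_integral => u _; rewrite patchE.
case: ifPn => [/set_mem|uN].
  rewrite /= in_itv/= andbT => u0.
  transitivity (\int[leb]_s (\1_[set s | (u < h s)%R] s)%:E).
    apply: eq_integral => s _; rewrite !indicE; congr (_%:R)%:E; congr nat_of_bool.
    by apply/idP/idP => /set_mem us; apply/mem_set; move: us; rewrite /D /= u0.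
  rewrite integral_indic//= ?setIT//.
  rewrite (_ : [set s | _] = h @^-1` `]u, +oo[%classic).
    exact: measurable_preimage mh (measurable_itv _).
  by apply/seteqP; split => s; rewrite /= in_itv/= andbT.
apply: integral0_eq => s _; rewrite indicE memNset// /D /= => /andP[u0 _].
by move/negP: uN; apply; apply/mem_set; rewrite /= in_itv/= u0.
Qed.

Lemma mule_AGM (a b : \bar R) : 0 <= a -> 0 <= b ->
  4%:E * (a * b) <= (a + b) * (a + b).
Proof.
move: a b => [a| |] [b| |]// a0 b0; last 3 first.
- by rewrite addey// mulyy leey.
- by rewrite addye// mulyy leey.
- by rewrite addye// mulyy leey.
rewrite -EFinD -!EFinM lee_fin.
by have := sqr_ge0 (a - b)%R; rewrite expr2; lra.
Qed.

(** The one-dimensional case of the Prekopa-Leindler inequality, with [s + t]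
    in place of the midpoint. After normalising the suprema of [f] and [g] to
    1, every superlevel set of [h] contains the sum of those of [f] and [g]. *)
Lemma prekopa_leindler1 (f g h : measurableTypeR R -> R) (k N M : R) :
  measurable_fun setT f -> measurable_fun setT g -> measurable_fun setT h ->
  (forall s, 0 <= f s <= N)%R -> (forall s, 0 <= g s <= N)%R ->
  (forall s, 0 <= h s)%R ->
  (forall s, 0 < f s -> `|s| <= M)%R -> (forall s, 0 < g s -> `|s| <= M)%R ->
  (0 < k)%R -> (forall s t, k * (f s * g t) <= h (s + t) ^+ 2)%R ->
  (4 * k)%:E * ((\int[leb]_s (f s)%:E) * (\int[leb]_s (g s)%:E)) <=
  (\int[leb]_s (h s)%:E) * (\int[leb]_s (h s)%:E).
Proof.
move=> mf mg mh f0 g0 h0 fM gM k0 fgh.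
have hsup (u : measurableTypeR R -> R) :
    (forall s, 0 <= u s <= N)%R -> has_sup (range u).
  move=> uN; split; first by exists (u 0%R), 0%R.
  by exists N => _ [s _ <-]; have /andP[] := uN s.
have fN := hsup f f0; have gN := hsup g g0.
set F := sup (range f); set G := sup (range g).
have fF s : (f s <= F)%R by apply: (ub_le_sup fN.2); exists s.
have gG s : (g s <= G)%R by apply: (ub_le_sup gN.2); exists s.
have F0 : (0 <= F)%R by apply: le_trans (fF 0%R); have /andP[] := f0 0%R.
have G0 : (0 <= G)%R by apply: le_trans (gG 0%R); have /andP[] := g0 0%R.
have hh0 : 0 <= \int[leb]_s (h s)%:E * \int[leb]_s (h s)%:E.
  by rewrite mule_ge0// integral_ge0// => s _; rewrite lee_fin.
have zero_int (u : measurableTypeR R -> R) U : (forall s, 0 <= u s <= N)%R ->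
    (forall s, u s <= U)%R -> U = 0%R -> \int[leb]_s (u s)%:E = 0.
  move=> u0 uU U0; apply: integral0_eq => s _; congr EFin; apply/eqP.
  by rewrite eq_le -{1}U0 uU; have /andP[] := u0 s.
have [F00|Fneq0] := eqVneq F 0%R.
  by rewrite (zero_int f F)// mul0e mule0.
have [G00|Gneq0] := eqVneq G 0%R.
  by rewrite (zero_int g G)// mule0 mule0.
have {}F0 : (0 < F)%R by rewrite lt_neqAle eq_sym Fneq0.
have {}G0 : (0 < G)%R by rewrite lt_neqAle eq_sym Gneq0.
pose H := Num.sqrt (k * (F * G)).
have HE : (H ^+ 2 = k * (F * G))%R by rewrite sqr_sqrtr// !mulr_ge0// ltW.
have H0 : (0 < H)%R by rewrite sqrtr_gt0 !mulr_gt0.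
have mdiv (u : measurableTypeR R -> R) U : measurable_fun setT u ->
    measurable_fun setT (fun s => u s / U)%R.
  by move=> mu; exact: measurable_funM.
have mlev (u : measurableTypeR R -> R) t : measurable_fun setT u ->
    measurable [set s | (t < u s)%R].
  move=> mu; rewrite (_ : [set s | _] = u @^-1` `]t, +oo[%classic).
    exact: measurable_preimage mu (measurable_itv _).
  by apply/seteqP; split => s; rewrite /= in_itv/= andbT.
have scaleI (u : measurableTypeR R -> R) U : measurable_fun setT u -> (0 < U)%R ->
    (forall s, 0 <= u s)%R ->
    \int[leb]_s (u s)%:E = U%:E * \int[leb]_s (u s / U)%:E.
  move=> mu U0 u0; rewrite -ge0_integralZl//; last 3 first.
  - by apply/measurable_EFinP; exact: mdiv.
  - by move=> s _; rewrite lee_fin divr_ge0// ltW.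
  - by rewrite lee_fin ltW.
  apply: eq_integral => s _; rewrite -EFinM; congr EFin.
  by rewrite mulrCA divff ?mulr1// gt_eqF.
have fge s : (0 <= f s)%R by have /andP[] := f0 s.
have gge s : (0 <= g s)%R by have /andP[] := g0 s.
rewrite (scaleI f F)// (scaleI g G)// (scaleI h H)//.
set a := \int[leb]_s (f s / F)%:E; set b := \int[leb]_s (g s / G)%:E.
set c := \int[leb]_s (h s / H)%:E.
have a0 : 0 <= a by apply: integral_ge0 => s _; rewrite lee_fin divr_ge0// ltW.
have b0 : 0 <= b by apply: integral_ge0 => s _; rewrite lee_fin divr_ge0// ltW.
have abc : a + b <= c.
  rewrite /a /b /c !ge0_layer_cake; last 6 first.
  - exact: mdiv.
  - by move=> s; rewrite divr_ge0// ltW.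
  - exact: mdiv.
  - by move=> s; rewrite divr_ge0// ltW.
  - exact: mdiv.
  - by move=> s; rewrite divr_ge0// ltW.
  have mlc (u : measurableTypeR R -> R) : measurable_fun setT u ->
      measurable_fun setT (fun t : measurableTypeR R => leb [set s | (t < u s)%R]).
    move=> mu.
    pose D := [set p : measurableTypeR R * measurableTypeR R | (p.2 < u p.1)%R].
    have mD : measurable D.
      pose t2 (p : measurableTypeR R * measurableTypeR R) := (p.2 < u p.1)%R.
      rewrite (_ : D = t2 @^-1` [set true])//; apply: measurable_preimage => //.
      by apply: measurable_fun_ltr => //; exact: measurableT_comp mu measurable_fst.
    apply: (eq_measurable_fun _ _ (measurable_fun_ysection leb mD)) => t _ /=.
    by congr (lebesgue_measure _); apply/seteqP; split => s; rewrite /ysection /= inE.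
  rewrite -ge0_integralD//; last 2 first.
  - by apply: measurable_funTS; apply: mlc; exact: mdiv.
  - by apply: measurable_funTS; apply: mlc; exact: mdiv.
  apply: ge0_le_integral => //.
  - by move=> t _; rewrite adde_ge0.
  - by apply: measurable_funTS; apply: emeasurable_funD; apply: mlc; exact: mdiv.
  - by apply: measurable_funTS; apply: mlc; exact: mdiv.
  move=> t; rewrite /= in_itv/= andbT => t0.
  have [t1|t1] := leP 1%R t.
    rewrite (_ : [set s | (t < f s / F)%R] = set0) ?measure0 ?add0e; last first.
      apply/seteqP; split => // s /=; rewrite ltr_pdivlMr// => ts.
      have : (F < F)%R by rewrite (le_lt_trans _ (lt_le_trans ts (fF s)))// ler_peMl// ltW.
      by rewrite ltxx.
    rewrite (_ : [set s | (t < g s / G)%R] = set0) ?measure0//.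
    apply/seteqP; split => // s /=; rewrite ltr_pdivlMr// => ts.
    have : (G < G)%R by rewrite (le_lt_trans _ (lt_le_trans ts (gG s)))// ler_peMl// ltW.
    by rewrite ltxx.
  apply: (@lebesgue_sumset _ _ _ M).
  - by apply: mlev; exact: mdiv.
  - by apply: mlev; exact: mdiv.
  - by apply: mlev; exact: mdiv.
  - have d0 : (0 < F - t * F)%R by rewrite subr_gt0 gtr_pMl.
    have [_ [s _ <-] sF] := sup_adherent d0 fN.
    by exists s; rewrite /= ltr_pdivlMr//; move: sF; rewrite -/F opprB addrC subrK.
  - have d0 : (0 < G - t * G)%R by rewrite subr_gt0 gtr_pMl.
    have [_ [s _ <-] sG] := sup_adherent d0 gN.
    by exists s; rewrite /= ltr_pdivlMr//; move: sG; rewrite -/G opprB addrC subrK.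
  - move=> s /=; rewrite ltr_pdivlMr// => ts; apply: fM.
    by apply: le_lt_trans ts; rewrite mulr_ge0// ltW.
  - move=> s /=; rewrite ltr_pdivlMr// => ts; apply: gM.
    by apply: le_lt_trans ts; rewrite mulr_ge0// ltW.
  - move=> s s' /=; rewrite !ltr_pdivlMr// => sf sg.
    rewrite -(@ltr_pXn2r _ 2) ?nnegrE ?mulr_ge0// ?(ltW H0)//.
    apply: lt_le_trans (fgh s s'); rewrite exprMn HE.
    rewrite (_ : (t ^+ 2 * (k * (F * G)) = k * ((t * F) * (t * G)))%R); last by ring.
    by rewrite ltr_pM2l// ltr_pM// mulr_ge0// ltW.
apply: (@le_trans _ _ ((k * (F * G))%:E * ((a + b) * (a + b)))).
  apply: (@le_trans _ _ ((k * (F * G))%:E * (4%:E * (a * b)))).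
    rewrite (_ : F%:E * a * (G%:E * b) = (F * G)%:E * (a * b)); last first.
      by rewrite EFinM muleACA.
    rewrite !muleA -!EFinM.
    by rewrite (_ : (4 * k * (F * G) = k * (F * G) * 4)%R) ?lexx//; ring.
  by rewrite lee_pmul2l ?mule_AGM// lte_fin !mulr_gt0.
rewrite -HE (_ : H%:E * c * (H%:E * c) = (H ^+ 2)%:E * (c * c)); last first.
  by rewrite expr2 EFinM muleACA.
rewrite lee_pmul2l ?lte_fin ?exprn_gt0//.
by apply: lee_pmul => //; exact: adde_ge0.
Qed.

End brunn_minkowski.

Section brunn_minkowski_cubes.
Local Open Scope ereal_scope.
Context {R : realType}.
Local Notation leb := (@lebesgue_measure R).

Let slice n (A : set 'rV[R]_n.+1) (s : measurableTypeR R) : set 'rV[R]_n :=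
  [set y | A (cons_rV (s, y))].

Let slice_xsection n (A : set 'rV[R]_n.+1) s :
  slice A s = xsection (@cons_rV R n @^-1` A) s.
Proof. by apply/seteqP; split => y; rewrite /xsection /slice /= inE. Qed.

Let measurable_slice n (A : set 'rV[R]_n.+1) s : measurable A -> measurable (slice A s).
Proof.
move=> mA; rewrite slice_xsection; apply: measurable_xsection.
exact: measurable_preimage (@measurable_cons_rV R n) mA.
Qed.

Let slice_cube n (A : set 'rV[R]_n.+1) (M s : R) : A `<=` cube M ->
  slice A s `<=` cube M.
Proof.
by move=> AM y /AM yM i; have := yM (@rshift 1 n i); rewrite cons_rV_tail.
Qed.

Let slice_head n (A : set 'rV[R]_n.+1) (M s : R) y : A `<=` cube M ->
  slice A s y -> (`|s| <= M)%R.
Proof. by move=> AM /AM/(_ ord0); rewrite cons_rV_head. Qed.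

Lemma volume_sub_cube n (A : set 'rV[R]_n) (M : R) : (0 <= M)%R -> measurable A ->
  A `<=` cube M -> volume A <= ((2 * M) ^+ n)%:E.
Proof.
move=> M0 mA AM; rewrite -volume_cube//; apply: le_measure; rewrite ?inE//.
exact: measurable_cube.
Qed.

Lemma volume_fin_num_cube n (A : set 'rV[R]_n) (M : R) : (0 <= M)%R ->
  measurable A -> A `<=` cube M -> volume A \is a fin_num.
Proof.
move=> M0 mA AM; rewrite ge0_fin_numE ?measure_ge0//.
by rewrite (le_lt_trans (volume_sub_cube M0 mA AM))// ltry.
Qed.

(** Induction on the dimension: by the induction hypothesis, the volumes of the
    slices of [A], [B] and [C] satisfy the hypothesis of [prekopa_leindler1].
    As [A + B] is twice the set of midpoints, the factor [4 ^+ n] makes this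
    the multiplicative form of the inequality. The set [C] is any measurable
    set that contains the sumset. *)
Lemma brunn_minkowski n (A B C : set 'rV[R]_n) (M : R) : (0 <= M)%R ->
  measurable A -> measurable B -> measurable C ->
  A `<=` cube M -> B `<=` cube M -> C `<=` cube M ->
  (forall a b, A a -> B b -> C (a + b)%R) ->
  (4 ^+ n)%:E * (volume A * volume B) <= volume C * volume C.
Proof.
move=> M0; elim: n A B C => [|n ih] A B C mA mB mC AM BM CM ABC.
  rewrite expr0 mul1e /= !diracE.
  have [/set_mem A0|_] := boolP (0%R \in A); last by rewrite mul0e mule_ge0.
  have [/set_mem B0|_] := boolP (0%R \in B); last by rewrite mule0 mule_ge0.
  by rewrite mem_set// -(addr0 0%R); exact: ABC.
pose v (D : set 'rV[R]_n.+1) (s : measurableTypeR R) := fine (volume (slice D s)).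
have mv D : measurable D -> measurable_fun setT (v D).
  move=> mD; apply: (measurableT_comp (f := fine)) => //.
  have mcD : measurable (@cons_rV R n @^-1` D).
    exact: measurable_preimage (@measurable_cons_rV R n) mD.
  apply: (eq_measurable_fun _ _ (measurable_fun_xsection (@volume R n) mcD)).
  by move=> s _; rewrite slice_xsection.
have vfin D s : measurable D -> D `<=` cube M -> (v D s)%:E = volume (slice D s).
  move=> mD DM; rewrite fineK//; apply: (volume_fin_num_cube M0).
    exact: measurable_slice.
  exact: slice_cube.
have vN D : measurable D -> D `<=` cube M -> forall s, (0 <= v D s <= (2 * M) ^+ n)%R.
  move=> mD DM s; rewrite -!lee_fin vfin// measure_ge0/=; apply: volume_sub_cube => //.
    exact: measurable_slice.
  exact: slice_cube.
have vsupp D : measurable D -> D `<=` cube M -> forall s, (0 < v D s -> `|s| <= M)%R.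
  move=> mD DM s; rewrite -lte_fin vfin// => v0.
  have [y Dy] : slice D s !=set0.
    by apply/set0P/eqP => D0; move: v0; rewrite D0 measure0 ltxx.
  exact: slice_head DM Dy.
have vE D : measurable D -> D `<=` cube M -> volume D = \int[leb]_s (v D s)%:E.
  by move=> mD DM; rewrite volumeS; apply: eq_integral => s _; rewrite vfin.
rewrite !vE// exprS.
apply: (@prekopa_leindler1 _ _ _ _ _ ((2 * M) ^+ n) M) => //.
- exact: mv.
- exact: mv.
- exact: mv.
- exact: vN.
- exact: vN.
- by move=> s; have /andP[] := vN C mC CM s.
- exact: vsupp.
- exact: vsupp.
move=> s t; rewrite -lee_fin expr2 !EFinM !vfin//.
apply: ih.
- exact: measurable_slice.
- exact: measurable_slice.
- exact: measurable_slice.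
- exact: slice_cube.
- exact: slice_cube.
- exact: slice_cube.
by move=> y z Ay Bz; rewrite /slice /= (cons_rVD (s, y) (t, z)); exact: ABC.
Qed.

End brunn_minkowski_cubes.

(** * Parallel bodies and surface area *)

Section parallel_bodies.
Context {R : realType} {d : nat}.
Implicit Types (W : set 'rV[R]_d) (e : R).

Lemma norm_le_enorm (x : 'rV[R]_d) : `|x| <= enorm x.
Proof.
rewrite [leLHS]mx_normrE; apply/bigmax_leP; split=> [|[i j] _ /=].
  exact: enorm_ge0.
by rewrite (ord1 i); exact: coord_le_enorm.
Qed.

Lemma compact_eball e : compact (@eball R d e).
Proof.
apply: bounded_closed_compact.
  exists e; split; first exact: num_real.
  move=> r er x xe; apply: le_trans (norm_le_enorm x) _.
  by rewrite (le_trans xe)// ltW.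
apply: (@preimage_closed _ _ (@enorm R d) [set t | t <= e]).
  by move=> x _; exact: continuous_enorm.
exact: closed_le.
Qed.

Lemma compact_parallel_body W e : compact W -> compact (parallel_body W e).
Proof.
move=> cW; rewrite (_ : parallel_body W e =
    (fun p : 'rV[R]_d * 'rV[R]_d => p.1 + p.2) @` (W `*` eball e)).
  apply: continuous_compact.
    by apply: continuous_subspaceT; exact: add_continuous.
  by apply: compact_setX => //; exact: compact_eball.
apply/seteqP; split => x.
  by move=> [w Ww [b be <-]]; exists (w, b).
by move=> [[w b] [/= Ww be] <-]; exists w => //; exists b.
Qed.

Lemma compact_sub_cube W : compact W -> exists2 M : R, 0 <= M & W `<=` cube M.
Proof.
move=> /compact_bounded[M [_ WM]]; exists (`|M| + 1).
  by rewrite addr_ge0.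
move=> x Wx i; have : `|x| <= `|M| + 1.
  by apply: WM => //; rewrite (le_lt_trans (ler_norm M))// ltrDl.
apply: le_trans; rewrite [leRHS]mx_normrE.
by apply/bigmax_geP; right => /=; exists (ord0, i).
Qed.

Lemma compact_volume_fin_num W : compact W -> volume W \is a fin_num.
Proof.
move=> cW; have [M M0 WM] := compact_sub_cube cW.
by apply: (volume_fin_num_cube M0) => //; exact: compact_measurable_rV.
Qed.

Lemma sub_parallel_body W e : 0 <= e -> W `<=` parallel_body W e.
Proof.
by move=> e0 w Ww; exists w => //; exists 0; [exact: eball_gt0_center|rewrite addr0].
Qed.

Lemma parallel_body_le W e e' : e <= e' -> parallel_body W e `<=` parallel_body W e'.
Proof.
move=> ee' x [w Ww [b be <-]]; exists w => //; exists b => //.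
exact: le_trans be ee'.
Qed.

Lemma midpoint_convex W w w' : convex_set W -> W w -> W w' ->
  W (2^-1 *: (w + w')).
Proof.
move=> cW Ww Ww'.
have h0 : (0 : R) <= 2^-1 by [].
have h1 : (2^-1 : R) <= 1 by lra.
have := cW w w' (Itv01 h0 h1) (mem_set Ww) (mem_set Ww') => /set_mem.
rewrite /conv/= /unstable.onem (_ : 1 - 2^-1 = 2^-1 :> R); last lra.
by rewrite -scalerDr.
Qed.

Section compact_convex.
Variable W : set 'rV[R]_d.
Hypotheses (cW : compact W) (convW : convex_set W) (W0 : (0 < volume W)%E).

Let phi e : R := fine (volume (parallel_body W e)).

Lemma phiE e : volume (parallel_body W e) = (phi e)%:E.
Proof. by rewrite fineK// compact_volume_fin_num//; exact: compact_parallel_body. Qed.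

Lemma measurable_parallel_body e : measurable (parallel_body W e).
Proof. by apply: compact_measurable_rV; apply: compact_parallel_body. Qed.

Lemma phi_nondecreasing e e' : e <= e' -> phi e <= phi e'.
Proof.
move=> ee'; rewrite -lee_fin -!phiE; apply: le_measure; rewrite ?inE.
- exact: measurable_parallel_body.
- exact: measurable_parallel_body.
- exact: parallel_body_le.
Qed.

Lemma phi_gt0 e : 0 <= e -> 0 < phi e.
Proof.
move=> e0; rewrite -lte_fin -phiE (lt_le_trans W0)//.
apply: le_measure; rewrite ?inE; first exact: compact_measurable_rV.
  exact: measurable_parallel_body.
exact: sub_parallel_body.
Qed.

(** Since [W] is convex, the midpoint of a point of [W + a B] and one of
    [W + b B] is in [W + m B], where [m] is the mean of [a] and [b]. *)
Lemma phi_midpoint a b : phi a * phi b <= phi ((a + b) / 2) ^+ 2.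
Proof.
set m := (a + b) / 2.
pose C := (fun x : 'rV[R]_d => 2^-1 *: x) @^-1` parallel_body W m.
have cK e := @compact_parallel_body W e cW.
have mK := measurable_parallel_body.
have [M1 M10 aM1] := compact_sub_cube (cK a).
have [M2 M20 bM2] := compact_sub_cube (cK b).
have [M3 M30 mM3] := compact_sub_cube (cK m).
pose M := Num.max (Num.max M1 M2) (2 * M3).
have mC : measurable C.
  apply: measurable_preimage (mK m).
  by apply: measurable_rV_scale => //; exact: measurable_cst.
have cubeM (M' : R) : M' <= M -> @cube R d M' `<=` cube M.
  by move=> h x xM i; exact: le_trans (xM i) h.
have := @brunn_minkowski R d (parallel_body W a) (parallel_body W b) C M.
rewrite (volume_scale _ (mK m))// !phiE -!EFinM lee_fin => h.
have {h} : 4 ^+ d * (phi a * phi b) <=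
    2^-1 ^- d * phi m * (2^-1 ^- d * phi m).
  apply: h => //.
  - by rewrite !le_max M10.
  - by move=> x /aM1; apply: cubeM; rewrite !le_max lexx.
  - by move=> x /bM2; apply: cubeM; rewrite !le_max lexx orbT.
  - move=> x /mM3 xM i; have := xM i; rewrite mxE normrM gtr0_norm// => h.
    rewrite !le_max; apply/orP; right; lra.
  - move=> _ _ [w Ww [u ua <-]] [w' Ww' [u' u'b <-]]; rewrite /C /=.
    exists (2^-1 *: (w + w')); first exact: midpoint_convex.
    exists (2^-1 *: (u + u')); last by rewrite -scalerDr addrACA.
    rewrite /eball /= enormZ gtr0_norm// /m mulrC ler_pM2r//.
    by rewrite (le_trans (ler_enormD _ _))// lerD.
rewrite exprVn invrK mulrACA -exprMn -natrM -expr2.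
by rewrite ler_pM2l// exprn_gt0.
Qed.

End compact_convex.

End parallel_bodies.

Section midpoint_concave.
Context {R : realType}.

Lemma midpoint_concave_seq (u : nat -> R) : u 0%N = 0 ->
  (forall k, u k + u k.+2 <= 2 * u k.+1) ->
  forall n m, (n <= m)%N -> n%:R * u m <= m%:R * u n.
Proof.
move=> u0 uc; have uS n : n%:R * u n.+1 <= n.+1%:R * u n.
  elim: n => [|n ih]; first by rewrite mul0r mul1r u0.
  have := ler_wpM2l (ler0n R n.+1) (uc n); rewrite -[n.+2%:R]natr1.
  by move: ih; rewrite -[n.+1%:R]natr1; lra.
move=> n; elim=> [|m ih]; first by rewrite leqn0 => /eqP ->.
rewrite leq_eqVlt => /predU1P[->//|]; rewrite ltnS => nm.
have [m0|m0] := eqVneq m 0%N.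
  by move: nm; rewrite m0 leqn0 => /eqP ->; rewrite mul0r u0 mulr0.
have {m0} m0 : 0 < m%:R :> R by rewrite ltr0n lt0n.
rewrite -(ler_pM2l m0).
have h1 := ler_wpM2l (ler0n R n) (uS m).
have h2 := ler_wpM2l (ler0n R m.+1) (ih nm).
by move: h1 h2; lra.
Qed.

(** Concavity along the multiples of [y / m] compares [v] at [y] and at the
    largest multiple below [x]; let [m] tend to infinity. *)
Lemma midpoint_concave_slope (v : R -> R) : v 0 = 0 ->
  (forall a b, 0 <= a -> a <= b -> v a <= v b) ->
  (forall a b, 0 <= a -> 0 <= b -> v a + v b <= 2 * v ((a + b) / 2)) ->
  forall x y, 0 < x -> x <= y -> v y / y <= v x / x.
Proof.
move=> v0 vnd vc x y x0 xy; have y0 : 0 < y by exact: lt_le_trans xy.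
have vy0 : 0 <= v y by rewrite -v0 vnd// ltW.
rewrite ler_pdivrMr// mulrAC ler_pdivlMr//.
apply/ler_addgt0Pr => e e0.
have [m me] : exists m : nat, v y * y <= e * m.+1%:R.
  exists (Num.trunc (v y * y / e)).
  by rewrite [leRHS]mulrC -ler_pdivrMr// ltW// truncnS_gt.
set M : R := m.+1%:R in me; have M0 : 0 < M by rewrite ltr0n.
have xMy : 0 <= x * M / y by rewrite divr_ge0// ?mulr_ge0// ltW.
set n := Num.trunc (x * M / y).
have /andP[] := truncn_itv xMy; rewrite -/n => nx xn.
have nm : (n <= m.+1)%N.
  rewrite -(ler_nat R) (le_trans nx)// ler_pdivrMr// mulrC ler_pM2l//.
have uc k : v (k%:R * (y / M)) + v (k.+2%:R * (y / M)) <= 2 * v (k.+1%:R * (y / M)).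
  have p0 j : 0 <= j%:R * (y / M) by rewrite mulr_ge0// divr_ge0// ltW.
  have := vc _ _ (p0 k) (p0 k.+2); congr (_ <= 2 * v _).
  by rewrite -[k.+2%:R]natr1 -[k.+1%:R]natr1; field; rewrite gt_eqF.
have := @midpoint_concave_seq (fun k => v (k%:R * (y / M))) _ uc n m.+1 nm.
rewrite mul0r v0 => /(_ erefl).
rewrite -/M [M * (y / M)]mulrCA divff ?gt_eqF// mulr1 => h.
have nx' : v (n%:R * (y / M)) <= v x.
  apply: vnd; first by rewrite mulr_ge0// divr_ge0// ltW.
  by rewrite mulrA ler_pdivrMr// -ler_pdivlMr.
have {}xn : x * M <= n.+1%:R * y by rewrite -ler_pdivrMr// ltW.
rewrite -(ler_pM2r M0).
have h1 : M * v (n%:R * (y / M)) <= M * v x by rewrite ler_wpM2l// ltW.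
have h2 := ler_wpM2l vy0 xn.
have h3 := ler_wpM2l (ltW y0) (le_trans h h1).
move: h2 h3; rewrite -natr1; lra.
Qed.

End midpoint_concave.

Section surface_area_limit.
Context {R : realType} {d : nat}.
Variable W : set 'rV[R]_d.
Hypotheses (cW : compact W) (convW : convex_set W) (W0 : (0 < volume W)%E).

Let phi e : R := fine (volume (parallel_body W e)).

Let phi_E e : volume (parallel_body W e) = (phi e)%:E.
Proof. exact: phiE. Qed.

Let phi_pos e : 0 <= e -> 0 < phi e.
Proof. exact: phi_gt0. Qed.

Lemma parallel_body0 : parallel_body W 0 = W.
Proof.
apply/seteqP; split; last exact: sub_parallel_body.
move=> x [w Ww [b b0 <-]]; suff -> : b = 0 by rewrite addr0.
by apply/eqP; rewrite -enorm_eq0 eq_le b0 enorm_ge0.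
Qed.

Let volW : volume W = (phi 0)%:E.
Proof. by rewrite -phi_E parallel_body0. Qed.

Let bigcap_parallel_body :
  \bigcap_(n : nat) parallel_body W (n.+1%:R^-1) = W.
Proof.
apply/seteqP; split=> [x Kx|x Wx n _]; last by apply: sub_parallel_body.
have clW : closed W by exact: compact_closed (@norm_hausdorff _ _) cW.
apply: clW => U /nbhs_ballP[e /= e0 eU].
have := @near_infty_natSinv_lt R (PosNum e0) => /filter_ex[n /= ne].
have [w Ww [b be xE]] := Kx n I; exists w; split => //.
apply: eU; rewrite -ball_normE /= -xE addrAC subrr add0r.
by apply: le_lt_trans (norm_le_enorm b) _; apply: le_lt_trans be ne.
Qed.

(** [W] is closed, hence the intersection of its parallel bodies. *)
Lemma phi_right_continuous : phi e @[e --> 0^'+] --> phi 0.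
Proof.
have cvn : (phi n.+1%:R^-1)%:E @[n --> \oo] --> (phi 0)%:E.
  rewrite -volW -[in X in _ --> X]bigcap_parallel_body.
  rewrite (_ : (fun n : nat => (phi n.+1%:R^-1)%:E) =
      (fun n => volume (parallel_body W n.+1%:R^-1))); last first.
    by apply/funext => n; rewrite phi_E.
  apply: (@nonincreasing_cvg_mu _ _ _ (@volume R d)
    (fun n => parallel_body W n.+1%:R^-1)).
  - by have := ltry (phi 1^-1); rewrite -phi_E.
  - by move=> n; exact: measurable_parallel_body.
  - by rewrite bigcap_parallel_body; exact: compact_measurable_rV.
  - move=> n m nm; apply/subsetPset; apply: parallel_body_le.
    by rewrite lef_pV2 ?posrE// ler_nat.
have {cvn} cvn : phi n.+1%:R^-1 @[n --> \oo] --> phi 0.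
  exact: fine_cvg cvn.
apply/cvgrPdist_le => e e0.
have [n /= pn] : exists n : nat, `|phi 0 - phi n.+1%:R^-1| <= e.
  by have /cvgrPdist_le/(_ e e0)/filter_ex := cvn.
near=> h.
have h0 : 0 <= h by near: h; exact: nbhs_right_ge.
have hn : h <= n.+1%:R^-1 by near: h; apply: nbhs_right_le; rewrite invr_gt0.
move: pn; have p0 : phi 0 <= phi h by exact: phi_nondecreasing.
have p1 : phi h <= phi n.+1%:R^-1 by exact: phi_nondecreasing.
by rewrite distrC ger0_norm ?subr_ge0 ?(le_trans p0)// distrC ger0_norm ?subr_ge0//; lra.
Unshelve. all: by end_near. Qed.

(** The limit in the definition of the surface area exists: by
    [phi_midpoint] and the arithmetic-geometric mean inequality, the inverse of
    the volume of the parallel body is midpoint convex in the radius, so its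
    difference quotients at 0 are monotone; they are carried over to the volume
    itself by right continuity. *)
Lemma surface_area_cvg :
  ((volume (parallel_body W e) - volume W) * (e^-1)%:E)%E @[e --> 0^'+] -->
  surface_area W.
Proof.
pose v e := (phi 0)^-1 - (phi e)^-1.
have slope x y : 0 < x -> x <= y -> v y / y <= v x / x.
  apply: midpoint_concave_slope; first by rewrite /v subrr.
    move=> a b a0 ab; rewrite /v lerD2l lerN2.
    by rewrite lef_pV2 ?posrE ?phi_pos// ?(le_trans a0)//; exact: phi_nondecreasing.
  move=> a b a0 b0; rewrite /v; set p := (phi a)^-1; set q := (phi b)^-1.
  set r := (phi ((a + b) / 2))^-1.
  have m0 : 0 <= (a + b) / 2 by rewrite divr_ge0// addr_ge0.
  have p0 : 0 < p by rewrite invr_gt0 phi_pos.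
  have q0 : 0 < q by rewrite invr_gt0 phi_pos.
  have r0 : 0 < r by rewrite invr_gt0 phi_pos.
  have pqr : r ^+ 2 <= p * q.
    rewrite exprVn -invfM lef_pV2 ?posrE ?exprn_gt0 ?mulr_gt0 ?phi_pos//.
    exact: phi_midpoint.
  suff : 2 * r <= p + q by lra.
  rewrite -(@ler_pXn2r _ 2) ?nnegrE ?mulr_ge0 ?addr_ge0// ?(ltW p0) ?(ltW q0) ?(ltW r0)//.
  by have := sqr_ge0 (p - q); rewrite sqrrB sqrrD exprMn; lra.
set L := ereal_sup ((fun e => (v e / e)%:E) @` [set` `]0, 1[%R]).
have cvs : (v e / e)%:E @[e --> 0^'+] --> L.
  apply: (@nonincreasing_at_right_cvge R (fun e => (v e / e)%:E) 0 (BLeft 1)).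
    by rewrite bnd_simp.
  move=> x y; rewrite !in_itv/= => /andP[x0 _] _ xy; rewrite lee_fin.
  exact: slope.
suff : cvg (((volume (parallel_body W e) - volume W) * (e^-1)%:E)%E @[e --> 0^'+]).
  by [].
apply/cvg_ex; exists (L * (phi 0 * phi 0)%:E)%E.
have cvp : (phi 0 * phi e)%:E @[e --> 0^'+] --> (phi 0 * phi 0)%:E.
  apply: cvg_EFin; first by near=> e.
  by apply: cvgMr; exact: phi_right_continuous.
have := cvgeM _ cvs cvp => /(_ _)cvm.
apply: cvg_trans (cvm _); last first.
  have [Lf|Lf] := boolP (L \is a fin_num); first exact: mule_def_fin.
  by apply: mule_def_infty_neq0 => //; rewrite eqe gt_eqF// mulr_gt0 ?phi_pos.
apply: near_eq_cvg; near=> e.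
have e0 : 0 < e by near: e; exact: nbhs_right_gt.
rewrite volW phi_E -EFinB -!EFinM; congr EFin; rewrite /v.
have := phi_pos (ltW e0); have := phi_pos (lexx 0) => p0 pe.
by field; rewrite !gt_eqF.
Unshelve. all: by end_near. Qed.

End surface_area_limit.

(** * Reflections and nearest points *)

Section reflection.
Context {R : realType} {n : nat}.

(** The reflection in the hyperplane orthogonal to the difference of [u] and the
    first basis vector. *)
Lemma householder (u : 'rV[R]_n.+1) : enorm u = 1 ->
  exists f : 'rV[R]_n.+1 -> 'rV[R]_n.+1,
    [/\ measurable_fun setT f, {morph f : x y / x + y}, involutive f,
        forall x, enorm (f x) = enorm x &
        forall y, f y ord0 ord0 = dotp u y].
Proof.
move=> u1; pose e : 'rV[R]_n.+1 := \row_j (j == ord0)%:R.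
have dote y : dotp e y = y ord0 ord0.
  rewrite /dotp (bigD1 ord0)//= mxE eqxx mul1r big1 ?addr0// => j /negPf j0.
  by rewrite mxE j0 mul0r.
have e1 : dotp e e = 1 by rewrite dote mxE eqxx.
have u11 : dotp u u = 1 by rewrite -sqr_enorm u1 expr1n.
have [ue|ue] := eqVneq u e.
  by exists id; split => // y; rewrite ue dote.
have [v vE] : exists v, v = u - e by exists (u - e).
pose q := dotp v v.
have q0 : q != 0 by rewrite dotp_eq0 vE subr_eq0.
pose c x : R := 2 * dotp v x / q.
pose f x := x - c x *: v.
have dotf x y : dotp (f x) (f y) = dotp x y.
  rewrite /f !(dotpDl, dotpDr, dotpNl, dotpNr, dotpZl, dotpZr) -/q /c (dotpC x v).
  by field.
have fu : f u = e.
  suff -> : f u = u - v by rewrite vE opprB addrC subrK.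
  congr (_ - _); rewrite -[RHS]scale1r; congr (_ *: _); rewrite /c.
  apply/(canLR (mulfK q0)); rewrite mul1r /q vE.
  by rewrite !(dotpDl, dotpDr, dotpNl, dotpNr) u11 e1 (dotpC e u); ring.
have mc : measurable_fun setT c.
  apply: measurable_funM => //; apply: measurable_funM => //.
  exact: measurable_dotp.
exists f; split.
- apply: (measurable_rV_add (f := fun x => x)); first exact: measurable_id.
  apply: measurable_rV_opp; apply: measurable_rV_scale => //.
- move=> x y; rewrite /f /c dotpDr mulrDr mulrDl scalerDl opprD addrACA.
  by [].
- move=> x; have cf : c (f x) = - c x.
    by rewrite /c /f dotpDr dotpNr dotpZr -/q /c; field.
  by rewrite {1}/f cf scaleNr opprK subrK.
- by move=> x; rewrite !enorm_dotp dotf.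
- by move=> y; rewrite -dote -fu dotf.
Qed.

End reflection.

Section nearest_point.
Context {R : realType} {d : nat}.
Variable W : set 'rV[R]_d.
Hypotheses (cW : compact W) (W0 : W !=set0).

Definition edist (x : 'rV[R]_d) : R := inf [set enorm (x - w) | w in W].

Lemma edist_attained x : exists2 p, W p & edist x = enorm (x - p).
Proof.
have [p Wp pmin] : exists2 c, c \in W &
    forall w, w \in W -> enorm (x - c) <= enorm (x - w).
  apply: (@EVT_min_rV R d (fun w => enorm (x - w))) => //.
  apply: continuous_subspaceT => w.
  have cB : {for w, continuous (fun w : 'rV[R]_d => x - w)}.
    apply: (@continuousB _ _ _ (fun=> x) (fun w : 'rV[R]_d => w) w).
      exact: cst_continuous.
    exact: cvg_id.
  apply: (@continuous_comp _ _ _ (fun w : 'rV[R]_d => x - w) (@enorm R d) w cB).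
  exact: continuous_enorm.
exists p; first exact: set_mem.
apply/eqP; rewrite eq_le; apply/andP; split.
  apply: ge_inf; last by exists p => //; exact: set_mem.
  by exists 0 => _ [w _ <-]; exact: enorm_ge0.
apply: lb_le_inf; first by exists (enorm (x - p)), p => //; exact: set_mem.
by move=> _ [w Ww <-]; apply: pmin; exact: mem_set.
Qed.

Lemma edist_le x r : (edist x <= r) = `[< parallel_body W r x >].
Proof.
apply/idP/asboolP => [|[w Ww [b br <-]]].
  have [p Wp ->] := edist_attained x => xp.
  by exists p => //; exists (x - p) => //; rewrite addrC subrK.
apply: le_trans br; rewrite (_ : enorm b = enorm (w + b - w)); last by rewrite addrAC subrr add0r.
apply: ge_inf; last by exists w.
by exists 0 => _ [w' _ <-]; exact: enorm_ge0.
Qed.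

Lemma measurable_edist : measurable_fun setT edist.
Proof.
apply: (measurability (@RGenOInfty.G R)) => [|/= _ [_] [r] -> <-].
  exact: RGenOInfty.measurableE.
rewrite setTI (_ : _ @^-1` _ = ~` parallel_body W r).
  by apply: measurableC; exact: measurable_parallel_body.
apply/seteqP; split => x /=; rewrite in_itv/= andbT ltNge edist_le.
  by move=> /asboolPn.
by move=> ?; apply/asboolPn.
Qed.

(** The variational inequality of the projection: moving from [p] towards [w]
    inside [W] does not decrease the distance to [x]. *)
Lemma nearest_point_obtuse x p w : convex_set W -> W p -> W w ->
  edist x = enorm (x - p) -> dotp (w - p) (x - p) <= 0.
Proof.
move=> convW Wp Ww xp; set a := dotp _ _; set q := dotp (w - p) (w - p).
have main (t : R) : 0 < t -> t <= 1 -> 2 * a <= t * q.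
  move=> t0 t1; pose z := t *: w + (1 - t) *: p.
  have Wz : W z.
    have := convW w p (Itv01 (ltW t0) t1) (mem_set Ww) (mem_set Wp).
    by move/set_mem.
  have : enorm (x - p) <= enorm (x - z).
    rewrite -xp; apply: ge_inf; last by exists z.
    by exists 0 => _ [w' _ <-]; exact: enorm_ge0.
  rewrite -(@ler_pXn2r _ 2) ?nnegrE ?enorm_ge0// !sqr_enorm.
  have -> : x - z = (x - p) - t *: (w - p).
    by rewrite /z scalerBl scale1r scalerBr addrCA opprD addrA.
  rewrite !(dotpDl (x - p), dotpDr (x - p), dotpNl, dotpNr, dotpZl, dotpZr).
  rewrite (dotpC (x - p) (w - p)) -/a -/q => h.
  rewrite -(ler_pM2l t0); lra.
have q0 : 0 <= q by exact: dotp_ge0.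
rewrite -(@pmulr_rle0 _ 2)//; apply/ler_addgt0Pr => e e0; rewrite add0r.
pose t := Num.min 1 (e / (q + 1)).
have t0 : 0 < t by rewrite lt_min ltr01 divr_gt0// ltr_wpDl.
apply: le_trans (main t t0 _) _; first by rewrite ge_min lexx.
apply: (@le_trans _ _ (e / (q + 1) * q)).
  by rewrite ler_wpM2r// ge_min lexx orbT.
by rewrite mulrAC ler_pdivrMr ?ltr_wpDl// ler_pM2l// lerDl.
Qed.

End nearest_point.

(** * The covariogram and the surface area *)

Section deficit.
Local Open Scope ereal_scope.
Context {R : realType} {d : nat}.
Variable W : set 'rV[R]_d.
Hypothesis cW : compact W.

Let mW : measurable W. Proof. exact: compact_measurable_rV. Qed.

Let Wfin : volume W \is a fin_num. Proof. exact: compact_volume_fin_num. Qed.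

Definition translate (y : 'rV[R]_d) : set 'rV[R]_d := (fun x => x - y)%R @^-1` W.

Lemma image_translate y : [set (w + y)%R | w in W] = translate y.
Proof.
apply/seteqP; split => [_ [w Ww <-]|x Wx]; first by rewrite /translate /= addrK.
by exists (x - y)%R => //; rewrite subrK.
Qed.

Lemma measurable_translate y : measurable (translate y).
Proof.
apply: measurable_preimage mW.
by apply: measurable_rV_add; [exact: measurable_id|exact: measurable_cst].
Qed.

Lemma volume_translate y : volume (translate y) = volume W.
Proof. exact: volumeD. Qed.

(** The amount [V(W) - g_W(y)] by which the covariogram falls short of its
    value at the origin. *)
Definition deficit (y : 'rV[R]_d) : \bar R := volume (W `\` translate y).

Lemma deficit_ge0 y : 0 <= deficit y.
Proof. exact: measure_ge0. Qed.

Lemma covariogram_deficit y : covariogram W y + deficit y = volume W.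
Proof.
rewrite /covariogram image_translate /deficit addeC.
exact: esym (measureDI (@volume R d) mW (measurable_translate y)).
Qed.

Lemma covariogram_fin_num y : covariogram W y \is a fin_num.
Proof.
rewrite ge0_fin_numE ?measure_ge0//.
apply: le_lt_trans (_ : volume W < +oo); last by rewrite -ge0_fin_numE ?measure_ge0.
by rewrite -(covariogram_deficit y) leeDl// deficit_ge0.
Qed.

(** [W] and its translate have the same volume, so each loses as much to the
    other. The points outside [W] are those that parallel bodies count. *)
Lemma deficit_outer y : deficit y = volume (translate y `\` W).
Proof.
have h := measureDI (@volume R d) mW (measurable_translate y).
have h' := measureDI (@volume R d) (measurable_translate y) mW.
have cfin : volume (W `&` translate y) \is a fin_num.
  by rewrite -image_translate; exact: covariogram_fin_num.
rewrite /deficit -[LHS](addeK _ cfin) -[RHS](addeK _ cfin); congr (_ - _).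
transitivity (volume W); first exact: esym h.
rewrite setIC; transitivity (volume (translate y)); last exact: h'.
by rewrite volume_translate.
Qed.

(** A point of [W] that is not in [W + y + z] is either not in [W + y], or in
    the translate by [y] of the points of [W] that are not in [W + z]. *)
Lemma deficitD y z : deficit (y + z)%R <= deficit y + deficit z.
Proof.
have mD (A B : set 'rV[R]_d) : measurable A -> measurable B -> measurable (A `\` B).
  exact: measurableD.
have mT := measurable_translate.
pose S := (fun x => x - y)%R @^-1` (W `\` translate z).
have mS : measurable S.
  apply: measurable_preimage (mD _ _ mW (mT z)).
  by apply: measurable_rV_add; [exact: measurable_id|exact: measurable_cst].
have -> : deficit z = volume S.
  by rewrite /S (volumeD (- y)%R)//; exact: mD.
apply: (@le_trans _ _ (volume ((W `\` translate y) `|` S))); last first.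
  by apply: measureU2 => //; exact: mD.
apply: le_measure; rewrite ?inE.
- exact: mD.
- by apply: measurableU => //; exact: mD.
move=> x [Wx nx]; have [xy|xy] := pselect (translate y x); last by left.
by right; split => // xyz; apply: nx; move: xyz; rewrite /translate /= opprD addrA.
Qed.

Lemma deficit0 : deficit 0%R = 0.
Proof.
rewrite /deficit (_ : W `\` translate 0%R = set0) ?measure0//.
by apply/seteqP; split => // x [Wx]; rewrite /translate /= subr0.
Qed.

(** Reduces long displacements to short ones, for which the volume of the
    parallel body is controlled by the surface area. *)
Lemma deficit_natmul k y : deficit (k%:R *: y)%R <= k%:R%:E * deficit y.
Proof.
elim: k => [|k ih]; first by rewrite scale0r deficit0 mul0e.
rewrite -natr1 scalerDl scale1r EFinD ge0_muleDl ?lee_fin// mul1e.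
by apply: le_trans (deficitD _ _) _; rewrite leeD2r.
Qed.

Lemma measurable_deficit : measurable_fun setT deficit.
Proof.
pose E : set ('rV[R]_d * 'rV[R]_d) :=
  (snd @^-1` W) `\` ((fun p => p.2 - p.1)%R @^-1` W).
have mE : measurable E.
  apply: measurableD; apply: measurable_preimage mW; first exact: measurable_snd.
  apply: measurable_rV_add; first exact: measurable_snd.
  by apply: measurable_rV_opp; exact: measurable_fst.
apply: (eq_measurable_fun _ _ (measurable_fun_xsection (@volume R d) mE)) => y _ /=.
by congr (volume _); apply/seteqP; split => x; rewrite /xsection /= inE.
Qed.

End deficit.

Section covariogram_bound.
Local Open Scope ereal_scope.
Context {R : realType} {n : nat}.
Variable W : set 'rV[R]_n.+1.
Hypotheses (cW : compact W) (convW : convex_set W) (W0 : 0 < volume W).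
Variable tau : R.
Hypothesis htau : (- n.+1%:R < tau)%R.

Let Wn0 : W !=set0.
Proof. by apply/set0P/eqP => WE; move: W0; rewrite WE measure0 ltxx. Qed.

Let mW : measurable W. Proof. exact: compact_measurable_rV. Qed.

Let q (y : 'rV[R]_n.+1) : \bar R := (\1_(eball 1) y)%:E * (enorm y `^ tau)%:E.

Let mq : measurable_fun setT q.
Proof.
apply: emeasurable_funM; last exact: measurable_enorm_powR.
by apply/measurable_EFinP/measurable_indicP; exact: measurable_eball.
Qed.

Let q0 y : 0 <= q y.
Proof. by rewrite mule_ge0// lee_fin powR_ge0. Qed.

Let outer (r : R) : set 'rV[R]_n.+1 := [set x | ~ W x /\ (edist W x <= r)%R].

Section one_scale.
Variable e : R.
Hypothesis e0 : (0 < e)%R.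

Let E1 : set ('rV[R]_n.+1 * 'rV[R]_n.+1) :=
  [set p | translate W (e *: p.1)%R p.2 /\ ~ W p.2].
Let E2 : set ('rV[R]_n.+1 * 'rV[R]_n.+1) :=
  [set p | outer (e * height p.1)%R p.2].

Let mnW : measurable [set p : 'rV[R]_n.+1 * 'rV[R]_n.+1 | ~ W p.2].
Proof.
rewrite (_ : [set p | _] = ~` (snd @^-1` W))//.
by apply: measurableC; apply: measurable_preimage mW; exact: measurable_snd.
Qed.

Let mE1 : measurable E1.
Proof.
pose t (p : 'rV[R]_n.+1 * 'rV[R]_n.+1) := (p.2 - e *: p.1)%R.
rewrite (_ : E1 = (t @^-1` W) `&` [set p | ~ W p.2])//; apply: measurableI => //.
apply: measurable_preimage mW.
apply: measurable_rV_add; first exact: measurable_snd.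
apply: measurable_rV_opp; apply: measurable_rV_scale; first exact: measurable_cst.
exact: measurable_fst.
Qed.

Let mE2 : measurable E2.
Proof.
pose t (p : 'rV[R]_n.+1 * 'rV[R]_n.+1) := (edist W p.2 <= e * height p.1)%R.
rewrite (_ : E2 = [set p | ~ W p.2] `&` (t @^-1` [set true]))//.
apply: measurableI => //; apply: measurable_preimage => //.
apply: measurable_fun_ler.
  exact: measurableT_comp (measurable_edist cW Wn0) measurable_snd.
apply: measurable_funM => //.
exact: measurableT_comp (@measurable_height R n) measurable_fst.
Qed.

Lemma measurable_outer_volume :
  measurable_fun setT (fun y : 'rV[R]_n.+1 => volume (outer (e * height y)%R)).
Proof.
apply: (eq_measurable_fun _ _ (measurable_fun_xsection (@volume R n.+1) mE2)) => y _.
change (volume (xsection E2 y) = volume (outer (e * height y)%R)).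
by congr (volume _); apply/seteqP; split => x; rewrite /xsection /= inE.
Qed.

(** If [x - e y] is in [W], then it lies beyond the supporting hyperplane of
    [W] at the point nearest to [x], so that [y] is in a half-space; a
    reflection in the variable [y] makes its boundary horizontal. *)
Let cap_le x : \int[volume]_y (q y * (\1_E1 (y, x))%:E) <=
  \int[volume]_y (q y * (\1_E2 (y, x))%:E).
Proof.
have mG (E : set ('rV[R]_n.+1 * 'rV[R]_n.+1)) : measurable E ->
    measurable_fun setT (fun y => q y * (\1_E (y, x))%:E).
  move=> mE; apply: emeasurable_funM => //.
  apply: measurable_indic_comp mE _.
  by apply/measurable_fun_pair; [exact: measurable_id|exact: measurable_cst].
have [Wx|nWx] := pselect (W x).
  rewrite integral0_eq; first by apply: integral_ge0 => y _; rewrite mule_ge0.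
  by move=> y _; rewrite indicE memNset ?mule0// => -[_]; exact.
have [p Wp xp] := edist_attained cW Wn0 x.
have D0 : (0 < enorm (x - p))%R.
  by rewrite enorm_gt0 subr_eq0; apply: contra_not_neq nWx => ->.
set D := enorm (x - p) in D0 xp.
pose u := (D^-1 *: (x - p))%R.
have u1 : enorm u = 1%R.
  by rewrite enormZ ger0_norm ?invr_ge0 ?(ltW D0)// mulVf// gt_eqF.
have [f [mf fD fK f_iso fu]] := householder u1.
have := @ge0_integral_isometry R n.+1 f setT (fun y => q y * (\1_E2 (y, x))%:E)
  mf fD fK f_iso measurableT (mG _ mE2) => <-; last first.
  by move=> y _; rewrite mule_ge0.
rewrite preimage_setT; apply: ge0_le_integral => //.
- by move=> y _; rewrite mule_ge0.
- exact: mG.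
- by apply: (measurableT_comp (f := fun y => q y * (\1_E2 (y, x))%:E)) => //; exact: mG.
move=> y _; have -> : q (f y) = q y.
  rewrite /q f_iso !indicE; congr (_%:R%:E * _); congr nat_of_bool.
  by apply/idP/idP => /set_mem h; apply/mem_set; move: h; rewrite /eball /= f_iso.
apply: lee_wpmul2l => //.
rewrite lee_fin !indicE ler_nat; case: (boolP (_ \in E1)) => // /set_mem[/= Wxy _].
rewrite mem_set//; split=> //=; rewrite xp.
have := nearest_point_obtuse convW Wp Wxy xp.
rewrite addrAC dotpDl dotpNl -sqr_enorm -/D dotpZl => h.
have yD : (D <= e * (f y ord0 ord0))%R.
  rewrite fu /u dotpZl dotpC mulrCA ler_pdivlMl//.
  by move: h; rewrite expr2; lra.
by apply: le_trans yD _; rewrite ler_pM2l// /height le_max lexx.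
Qed.

(** Both sides are double integrals in [x] and [y], compared by [cap_le] once
    [y] is integrated first. *)
Lemma deficit_integral_outer :
  \int[volume]_y (q y * deficit W (e *: y)%R) <=
  \int[volume]_y (q y * volume (outer (e * height y)%R)).
Proof.
have mF (E : set ('rV[R]_n.+1 * 'rV[R]_n.+1)) : measurable E ->
    measurable_fun setT (fun p : 'rV[R]_n.+1 * 'rV[R]_n.+1 => q p.1 * (\1_E p)%:E).
  move=> mE; apply: emeasurable_funM; first exact: measurableT_comp mq measurable_fst.
  exact/measurable_EFinP/measurable_indic.
have F0 (E : set ('rV[R]_n.+1 * 'rV[R]_n.+1)) (p : 'rV[R]_n.+1 * 'rV[R]_n.+1) :
    0 <= q p.1 * (\1_E p)%:E by rewrite mule_ge0.
have tonelli (E : set ('rV[R]_n.+1 * 'rV[R]_n.+1)) : measurable E ->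
    \int[volume]_y (q y * volume (xsection E y)) =
    \int[volume]_x \int[volume]_y (q y * (\1_E (y, x))%:E).
  move=> mE.
  rewrite -(fubini_tonelli (fun p => q p.1 * (\1_E p)%:E) (mF E mE) (F0 E))/=.
  apply: eq_integral => y _; rewrite ge0_integralZl//; last first.
    apply: measurable_indic_comp mE _.
    by apply/measurable_fun_pair; [exact: measurable_cst|exact: measurable_id].
  congr (_ * _).
  transitivity (\int[volume]_x (\1_(xsection E y) x)%:E).
    exact: esym (integral_volume_indic (measurable_xsection y mE)).
  apply: eq_integral => x _; rewrite !indicE; congr (_%:R%:E); congr nat_of_bool.
  by apply/idP/idP => /set_mem h; apply/mem_set; move: h; rewrite /xsection /= inE.
have -> : \int[volume]_y (q y * deficit W (e *: y)%R) =
    \int[volume]_y (q y * volume (xsection E1 y)).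
  apply: eq_integral => y _; rewrite deficit_outer//; congr (_ * volume _).
  by apply/seteqP; split => x; rewrite /xsection /= inE.
have -> : \int[volume]_y (q y * volume (outer (e * height y)%R)) =
    \int[volume]_y (q y * volume (xsection E2 y)).
  apply: eq_integral => y _; congr (_ * volume _).
  by apply/seteqP; split => x; rewrite /xsection /= inE.
rewrite !tonelli//; apply: ge0_le_integral => //.
- by move=> x _; apply: integral_ge0 => y _; rewrite mule_ge0.
- exact: (measurable_fun_fubini_tonelli_G
    (fun p => q p.1 * (\1_E1 p)%:E) (mF E1 mE1) (F0 E1)).
- exact: (measurable_fun_fubini_tonelli_G
    (fun p => q p.1 * (\1_E2 p)%:E) (mF E2 mE2) (F0 E2)).
Qed.

End one_scale.

Let outerE r : outer r = parallel_body W r `\` W.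
Proof.
apply/seteqP; split => x; rewrite /outer /= edist_le// => -[].
  by move=> nWx /asboolP.
by move=> px nWx; split => //; apply/asboolP.
Qed.

Lemma outer_volume_le (s : R) : surface_area W < s%:E ->
  exists2 r0 : R, (0 < r0)%R &
    forall r, (0 <= r <= r0)%R -> volume (outer r) <= (s * r)%:E.
Proof.
move=> Ss; have := surface_area_cvg cW convW W0 => /(_ _ (open_ereal_lt' Ss)).
move=> [r1 r1P near_s]; have r10 : (0 < r1)%R := r1P; exists (r1 / 2)%R; first by rewrite divr_gt0.
move=> r /andP[]; rewrite le_eqVlt => /predU1P[<- _|r0 rr1].
  rewrite outerE parallel_body0 setDv measure0 mulr0//.
have r_r1 : (`|0 - r| < r1)%R.
  by rewrite sub0r normrN gtr0_norm//; move: r10; lra.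
have := near_s r r_r1 r0.
have Voo : volume (parallel_body W r) < +oo by rewrite phiE// ltry.
have -> : volume (outer r) = volume (parallel_body W r) - volume W.
  rewrite outerE measureD//; last exact: measurable_parallel_body.
  by congr (_ - volume _); rewrite setIidr//; apply: sub_parallel_body; exact: ltW.
have VW : volume W = (fine (volume W))%:E by rewrite fineK// compact_volume_fin_num.
have Vr : volume (parallel_body W r) = (fine (volume (parallel_body W r)))%:E.
  by rewrite fineK// ge0_fin_numE ?measure_ge0.
rewrite /preimage /mkset VW Vr -!EFinB -EFinM lee_fin lte_fin.
by rewrite ltr_pdivrMr// => /ltW.
Qed.

Let K : R := @kappa R n / (tau + n.+1%:R + 1).

Let K_gt0 : (0 < K)%R.
Proof. by rewrite divr_gt0 ?kappa_gt0//; move: htau; lra. Qed.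

(** The displacement [r *: y] is cut into [k + 1] steps [e *: y], with [e] small
    enough for [outer_volume_le]. *)
Let weighted_deficit_le (s r : R) : surface_area W < s%:E -> (0 <= s)%R ->
  (0 < r)%R -> \int[volume]_y (q y * deficit W (r *: y)%R) <= (r * s * K)%:E.
Proof.
move=> Ss s0 r0; have [r1 r10 out_s] := outer_volume_le Ss.
have [k rk] : exists k : nat, (r / r1 <= k.+1%:R)%R.
  by exists (Num.trunc (r / r1)); exact: ltW (truncnS_gt _).
have k0 : (0 < k.+1%:R :> R)%R by rewrite ltr0n.
pose e := (r / k.+1%:R)%R.
have e0 : (0 < e)%R by rewrite divr_gt0.
have er1 : (e <= r1)%R by rewrite ler_pdivrMr// mulrC -ler_pdivrMr.
have mdef (c : R) :
    measurable_fun setT (fun y : 'rV[R]_n.+1 => deficit W (c *: y)%R).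
  apply: (measurableT_comp (measurable_deficit cW)).
  by apply: measurable_rV_scale; [exact: measurable_cst|exact: measurable_id].
apply: (@le_trans _ _ (k.+1%:R%:E * \int[volume]_y (q y * deficit W (e *: y)%R))).
  rewrite -ge0_integralZl ?lee_fin//; last 2 first.
  - by apply: emeasurable_funM.
  - by move=> y _; rewrite mule_ge0// deficit_ge0.
  apply: ge0_le_integral => //.
  - by move=> y _; rewrite mule_ge0// deficit_ge0.
  - by apply: emeasurable_funM.
  - by apply: measurable_funeM; apply: emeasurable_funM.
  move=> y _; rewrite muleCA; apply: lee_wpmul2l => //.
  have := deficit_natmul cW k.+1 (e *: y)%R; rewrite scalerA /e mulrCA divff ?mulr1//.
apply: (@le_trans _ _ (k.+1%:R%:E * (e * s * K)%:E)); last first.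
  by rewrite -EFinM lee_fin /e le_eqVlt; apply/orP; left; apply/eqP; field; rewrite gt_eqF.
apply: lee_wpmul2l; first by rewrite lee_fin.
apply: le_trans (deficit_integral_outer e0) _.
pose g (y : 'rV[R]_n.+1) := (\1_(@eball R n.+1 1) y)%:E * ((enorm y `^ tau)%:E * (height y)%:E).
have mg : measurable_fun setT g.
  apply: emeasurable_funM.
    by apply/measurable_EFinP/measurable_indicP; exact: measurable_eball.
  apply: emeasurable_funM; first exact: measurable_enorm_powR.
  by apply/measurable_EFinP; exact: measurable_height.
have g0 y : 0 <= g y.
  by rewrite mule_ge0// mule_ge0// lee_fin ?powR_ge0 ?height_ge0.
have es0 : (0 <= e * s)%R by rewrite mulr_ge0// ltW.
apply: (@le_trans _ _ (\int[volume]_y ((e * s)%:E * g y))); last first.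
  rewrite ge0_integralZl//.
  by rewrite -integral_mul_indic integral_enorm_powR_height// -EFinM.
apply: ge0_le_integral => //.
- by move=> y _; rewrite mule_ge0.
- by apply: emeasurable_funM => //; exact: measurable_outer_volume.
- exact: measurable_funeM.
move=> y _; rewrite /q /g indicE.
case: (boolP (y \in _)) => [/set_mem y1|_]; last by rewrite !mul0e mule0.
rewrite !mul1e muleCA; apply: lee_wpmul2l; first by rewrite lee_fin powR_ge0.
have h1 : (height y <= 1)%R.
  rewrite /height ge_max ler01 andbT.
  by apply: le_trans (ler_norm _) _; apply: le_trans (coord_le_enorm y ord0) y1.
apply: le_trans (out_s _ _) _.
  rewrite mulr_ge0 ?height_ge0 ?(ltW e0)//=.
  by apply: le_trans er1; rewrite ger_pMr.
by rewrite -EFinM lee_fin mulrA [(s * e)%R]mulrC.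
Qed.

Let surface_area_ge0 : 0 <= surface_area W.
Proof.
rewrite leNgt; apply/negP => S0.
have near_neg := surface_area_cvg cW convW W0 (open_ereal_lt' S0).
near ((0 : R)^'+)%R => e.
have e0 : (0 < e)%R by near: e; exact: nbhs_right_gt.
have : (volume (parallel_body W e) - volume W) * (e^-1)%:E < 0.
  by near: e; exact: near_neg.
rewrite ltNge => /negP; apply; apply: mule_ge0; last by rewrite lee_fin invr_ge0 ltW.
rewrite sube_ge0; last by rewrite compact_volume_fin_num.
apply: le_measure; rewrite ?inE//; first exact: measurable_parallel_body.
by apply: sub_parallel_body; exact: ltW.
Unshelve. all: by end_near. Qed.

(** Scale the ball of radius [r] to the unit ball, and let [s] decrease to the
    surface area in [weighted_deficit_le]. *)
Lemma deficit_integral_le (r : R) : (0 < r)%R ->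
  \int[volume]_(y in eball r) ((enorm y `^ tau)%:E * deficit W y) <=
  (r `^ (tau + n.+1%:R) * (r * K))%:E * surface_area W.
Proof.
move=> r0; pose f y := (enorm y `^ tau)%:E * deficit W y.
have mf : measurable_fun setT f.
  by apply: emeasurable_funM; [exact: measurable_enorm_powR|exact: measurable_deficit].
have f0 y : 0 <= f y by rewrite mule_ge0 ?deficit_ge0// lee_fin powR_ge0.
have rn : (r ^+ n.+1 != 0)%R by rewrite expf_neq0// gt_eqF.
have -> : \int[volume]_(y in @eball R n.+1 r) f y =
    (r `^ (tau + n.+1%:R))%:E * \int[volume]_y (q y * deficit W (r *: y)%R).
  transitivity ((r ^+ n.+1)%:E * \int[volume]_(y in @eball R n.+1 1) f (r *: y)%R).
    rewrite -(preimage_scale_eball 1 r0) mulr1 ge0_integral_scale//; last 2 first.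
    - exact: measurable_eball.
    - exact: measurable_funTS.
    by rewrite muleA -EFinM divff// mul1e.
  rewrite powRD; last by rewrite (gt_eqF r0) implybT.
  rewrite powR_mulrn ?(ltW r0)// mulrC EFinM -muleA; congr (_ * _).
  transitivity (\int[volume]_y ((r `^ tau)%:E * (q y * deficit W (r *: y)%R))).
    transitivity (\int[volume]_y ((\1_(@eball R n.+1 1) y)%:E * f (r *: y)%R)).
      exact: integral_mul_indic.
    apply: eq_integral => y _; rewrite /f /q enormZ gtr0_norm//.
    by rewrite powRM ?(ltW r0) ?enorm_ge0// EFinM -!muleA; exact: muleCA.
  apply: ge0_integralZl.
  - exact: measurableT.
  - apply: emeasurable_funM => //.
    apply: (measurableT_comp (measurable_deficit cW)).
    by apply: measurable_rV_scale; [exact: measurable_cst|exact: measurable_id].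
  - by move=> y _; rewrite mule_ge0// deficit_ge0.
  - by rewrite lee_fin powR_ge0.
rewrite EFinM -muleA; apply: lee_wpmul2l; first by rewrite lee_fin powR_ge0.
have rK0 : (0 < r * K)%R by rewrite mulr_gt0.
case SE : (surface_area W) surface_area_ge0 => [S| |]// S0; last by rewrite mulry gtr0_sg// mul1e leey.
apply/lee_addgt0Pr => e e0; rewrite -EFinM -EFinD.
have ek : (0 < e / (r * K))%R by rewrite divr_gt0.
have := @weighted_deficit_le (S + e / (r * K))%R r.
rewrite SE lte_fin ltrDl ek => /(_ isT); rewrite addr_ge0 ?(ltW ek)// => /(_ isT r0) h.
apply: le_trans h _; rewrite lee_fin le_eqVlt; apply/orP; left; apply/eqP.
by field; rewrite !gt_eqF.
Qed.

End covariogram_bound.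

(** * Sums over the points of a random finite configuration *)

Section campbell.
Local Open Scope ereal_scope.
Context {R : realType} {dO dX : measure_display}.
Context {Omega : measurableType dO} {X : measurableType dX}.
Variables (P : {measure set Omega -> \bar R}) (nu : {measure set X -> \bar R}).
Variable s : Omega -> seq X.

Let count_in (C : set X) (w : Omega) : \bar R := \sum_(p <- s w) (\1_C p)%:E.

Let count_ge0 C w : 0 <= count_in C w.
Proof. by apply: sume_ge0 => p _. Qed.

Let intensity (C : set X) := measurable_fun setT (count_in C) /\
  \int[P]_w count_in C w = nu C.

(** As [nu] is finite, the sets that satisfy [intensity] form a lambda-system,
    and Dynkin's theorem applies. *)
Lemma intensity_pi_lambda (G : set (set X)) :
  setI_closed G -> G setT -> @measurable _ X = <<s G >> -> nu setT < +oo ->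
  (forall C, G C -> intensity C) -> forall C, measurable C -> intensity C.
Proof.
move=> GI GT mG nufin HG.
have nufinite C : measurable C -> nu C \is a fin_num.
  move=> mC; rewrite ge0_fin_numE//; apply: le_lt_trans nufin.
  by apply: le_measure; rewrite ?inE.
pose H := [set C | measurable C /\ intensity C].
suff : <<s G >> `<=` H by move=> + C mC => /(_ C); rewrite -mG => /(_ mC)[].
have mGC C : G C -> measurable C by rewrite mG; exact: sub_sigma_algebra.
apply: (lambda_system_subset GI (D := setT)); last 2 first.
- by move=> C GC; split; [exact: mGC|exact: HG].
- by [].
split=> //.
- by split; [exact: mGC|exact: HG].
- move=> A B BA [mA [mcA iA]] [mB [mcB iB]].
  have mAB : measurable (A `\` B) by exact: measurableD.
  have split_count w : count_in A w = count_in B w + count_in (A `\` B) w.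
    rewrite /count_in -big_split; apply: eq_bigr => p _ /=; rewrite -EFinD !indicE.
    congr EFin; rewrite in_setD; have [pB|pB] := boolP (p \in B).
      by rewrite (mem_set (BA _ (set_mem pB))) andbF addr0.
    by rewrite andbT add0r.
  have cfin C w : count_in C w \is a fin_num by rewrite /count_in sumEFin.
  have mcAB : measurable_fun setT (count_in (A `\` B)).
    rewrite (_ : count_in (A `\` B) = count_in A \- count_in B).
      exact: emeasurable_funB.
    by apply/funext => w /=; rewrite split_count [count_in B w + _]addeC addeK.
  split=> //; split=> //.
  have nuA : nu A = nu B + \int[P]_w count_in (A `\` B) w.
    rewrite -iA -iB -ge0_integralD//; apply: eq_integral => w _; exact: split_count.
  have nuB := nufinite B mB.
  have -> : nu (A `\` B) = nu A - nu B.
    rewrite measureD//; last by rewrite -ge0_fin_numE// nufinite.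
    by rewrite setIidr.
  by rewrite nuA [nu B + _]addeC addeK.
- move=> F ndF HF.
  have mU : measurable (\bigcup_n F n) by apply: bigcupT_measurable => k; have [] := HF k.
  have cvg_count w : count_in (F k) w @[k --> \oo] --> count_in (\bigcup_n F n) w.
    apply: cvg_nnesum => p _; first by near=> k.
    have [[N _ FN]|nF] := pselect ((\bigcup_n F n) p).
      apply: cvg_near_cst; near=> k.
      have Nk : (N <= k)%N by near: k; exact: nbhs_infty_ge.
      have Fk : F k p by have /subsetPset := ndF _ _ Nk; apply.
      by rewrite !indicE (mem_set Fk) (mem_set (ex_intro2 _ _ N I FN)).
    apply: cvg_near_cst; near=> k.
    have nFk : ~ F k p by move=> Fk; apply: nF; exists k.
    by rewrite !indicE (memNset nFk) (memNset nF).
  have nd_count w : nondecreasing_seq (count_in ^~ w \o F).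
    move=> k l kl; apply: lee_sum => p _; rewrite lee_fin !indicE ler_nat.
    case: (boolP (p \in F k)) => // /set_mem Fk; rewrite mem_set//.
    by have /subsetPset := ndF _ _ kl; apply.
  have mcU : measurable_fun setT (count_in (\bigcup_n F n)).
    apply: (emeasurable_fun_cvg (fun k => count_in (F k))) => //.
    by move=> k; have [_ []] := HF k.
  split=> //; split=> //.
  have := @cvg_monotone_convergence _ _ _ P setT measurableT
    (fun k => count_in (F k)) _ _ (fun w _ => nd_count w).
  move=> /(_ (fun k => (HF k).2.1) (fun k w _ => count_ge0 _ w)) cvi.
  have lim1 : \int[P]_w count_in (\bigcup_n F n) w =
      limn (fun k => \int[P]_w count_in (F k) w).
    rewrite (cvg_lim _ cvi)//; apply: eq_integral => w _.
    by apply/esym/cvg_lim => //; exact: cvg_count.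
  rewrite lim1 (_ : (fun k => _) = nu \o F); last first.
    by apply/funext => k /=; have [_ []] := HF k.
  apply/cvg_lim => //; apply: nondecreasing_cvg_mu => //.
  by move=> k; have [] := HF k.
Unshelve. all: by end_near. Qed.

Hypothesis intensityP : forall C, measurable C -> intensity C.

Import HBNNSimple.

Let campbell_nnsfun (g : {nnsfun X >-> R}) :
  measurable_fun setT (fun w => \sum_(p <- s w) (g p)%:E) /\
  \int[P]_w \sum_(p <- s w) (g p)%:E = \int[nu]_p (g p)%:E.
Proof.
pose r := fset_set (g @` setT).
pose A (i : 'I_#|` r|) := g @^-1` [set r`_i].
have mA i : measurable (A i) by exact: measurable_funPTI.
have r0 (i : 'I_#|` r|) : (0 <= r`_i)%R.
  have : r`_i \in r by exact: mem_nth.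
  by rewrite in_fset_set// => /set_mem[x _ <-].
have gE w : \sum_(p <- s w) (g p)%:E = \sum_(i < #|` r|) (r`_i)%:E * count_in (A i) w.
  under eq_bigr do rewrite fimfunEord -sumEFin.
  rewrite exchange_big; apply: eq_bigr => i _; rewrite ge0_sume_distrr//.
have mcA (i : 'I_#|` r|) : measurable_fun setT (fun w => (r`_i)%:E * count_in (A i) w).
  by apply: measurable_funeM; have [] := intensityP (mA i).
split.
  rewrite (_ : (fun w => _) =
      (fun w => \sum_(i < #|` r|) (r`_i)%:E * count_in (A i) w)).
    exact: emeasurable_sum.
  by apply/funext => w; exact: gE.
under eq_integral do rewrite gE.
rewrite ge0_integral_sum//; last by move=> i w _; rewrite mule_ge0// lee_fin.
under [RHS]eq_integral do rewrite fimfunEord -sumEFin.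
rewrite [RHS]ge0_integral_sum//; last 2 first.
- move=> i; apply/measurable_EFinP; apply: measurable_funM => //.
- by move=> i p _; rewrite lee_fin mulr_ge0.
apply: eq_bigr => i _; have [mc ic] := intensityP (mA i).
rewrite ge0_integralZl ?lee_fin// ic.
under [RHS]eq_integral do rewrite EFinM.
rewrite ge0_integralZl ?lee_fin//; last exact/measurable_EFinP.
by rewrite integral_indic// setIT.
Qed.

(** Indicators are the case of [intensityP]; nonnegative functions are limits of
    increasing sequences of simple functions. *)
Lemma campbell_formula (F : X -> \bar R) :
  measurable_fun setT F -> (forall p, 0 <= F p) ->
  measurable_fun setT (fun w => \sum_(p <- s w) F p) /\
  \int[P]_w \sum_(p <- s w) F p = \int[nu]_p F p.
Proof.
move=> mF F0; pose g := nnsfun_approx measurableT mF.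
pose S k w := \sum_(p <- s w) (g k p)%:E.
have cvgg p : (g k p)%:E @[k --> \oo] --> F p.
  by apply: cvg_nnsfun_approx => // x _; exact: F0.
have ndg p : nondecreasing_seq (fun k => (g k p)%:E).
  by move=> k l kl; rewrite lee_fin; exact/lefP/nd_nnsfun_approx.
have cvgS w : S k w @[k --> \oo] --> \sum_(p <- s w) F p.
  apply: cvg_nnesum => p _; last exact: cvgg.
  by near=> k; rewrite lee_fin.
have mS k : measurable_fun setT (S k) by have [] := campbell_nnsfun (g k).
split; first exact: (emeasurable_fun_cvg S).
have S0 k w : setT w -> 0 <= S k w by move=> _; apply: sume_ge0 => p _; rewrite lee_fin.
have ndS w : setT w -> nondecreasing_seq (S ^~ w).
  by move=> _ k l kl; apply: lee_sum => p _; exact: ndg.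
have cvi := @cvg_monotone_convergence _ _ _ P setT measurableT S mS S0 ndS.
have cvj := @cvg_monotone_convergence _ _ _ nu setT measurableT
  (fun k p => (g k p)%:E) _ _ (fun p _ => ndg p).
transitivity (limn (fun k => \int[P]_w S k w)).
  rewrite (cvg_lim _ cvi)//; apply: eq_integral => w _.
  by apply/esym/cvg_lim => //; exact: cvgS.
rewrite (_ : (fun k => _) = (fun k => \int[nu]_p (g k p)%:E)); last first.
  by apply/funext => k; have [_] := campbell_nnsfun (g k).
rewrite (cvg_lim _ (cvj _ _))//.
- by apply: eq_integral => p _; apply/cvg_lim => //; exact: cvgg.
- by move=> k; exact/measurable_EFinP.
- by move=> k p _; rewrite lee_fin.
Unshelve. all: by end_near. Qed.

End campbell.

(** * Second factorial moments of a Poisson process *)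

Section poisson_factorial_moment.
Local Open Scope ereal_scope.
Context {R : realType}.

Lemma ge0_integral_nat (mu : {measure set nat -> \bar R}) (g : nat -> \bar R) :
  (forall k, 0 <= g k) ->
  \int[mu]_k g k = \sum_(0 <= k <oo) (g k * mu [set k]).
Proof.
move=> g0; rewrite (_ : setT = \bigcup_k [set k]); last first.
  by apply/seteqP; split => // k _; exists k.
rewrite ge0_integral_bigcup//.
  apply: eq_eseriesr => k _.
  transitivity (\int[mu]_(x in [set k]) cst (g k) x); last by rewrite integral_cst.
  by apply: eq_integral => x /set_mem ->.
by apply/trivIsetP => i j _ _ ij; apply/seteqP; split => // x [-> /= ji]; rewrite ji eqxx in ij.
Qed.

(** Cancelling [k * k.-1] against the factorial shifts the Poisson weights by
    two. *)
Lemma poisson_factorial_moment (r : R) : (0 <= r)%R ->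
  \int[poisson_prob r 0%N]_k ((k * k.-1)%:R)%:E = (r ^+ 2)%:E.
Proof.
move=> r0; rewrite (ge0_integral_nat (poisson_prob r 0%N))//.
move: r0; rewrite le_eqVlt => /predU1P[<-|r0].
  rewrite expr0n /= eseries0// => k _ _; rewrite /poisson_prob ltxx diracE.
  by case: k => [|k]; rewrite ?mul0e// memNset ?mule0// => /=.
have pmfE k : poisson_prob r 0%N [set k] = (poisson_pmf r k)%:E.
  by rewrite /poisson_prob r0 esum_set1// lee_fin poisson_pmf_ge0.
transitivity (\sum_(0 <= k <oo) ((k * k.-1)%:R * poisson_pmf r k)%:E).
  by apply: eq_eseriesr => k _; rewrite EFinM -pmfE.
have pmf0 k : (0 <= poisson_pmf r k)%R by exact: poisson_pmf_ge0.
rewrite (nneseries_split 0 2); last by move=> k _; rewrite lee_fin mulr_ge0.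
rewrite add0n big_nat_recr//= big_nat1 /= !mul0r !add0e.
rewrite -nneseries_addn; last by move=> k; rewrite lee_fin mulr_ge0.
transitivity (\sum_(0 <= k <oo) ((r ^+ 2)%:E * (poisson_pmf r k)%:E)).
  apply: eq_eseriesr => k _; rewrite -EFinM; congr EFin.
  rewrite /poisson_pmf r0 addn2 /= !factS !natrM exprSr exprSr.
  have k0 : (k`!%:R != 0 :> R)%R by rewrite pnatr_eq0 -lt0n fact_gt0.
  by field; rewrite k0 -(natrD _ 1 k) -(natrD _ 2 k) !pnatr_eq0.
rewrite nneseriesZl//; last by move=> k _; rewrite lee_fin.
have : poisson_prob r 0%N setT = 1 by exact: probability_setT.
rewrite /poisson_prob r0 -nneseries_esumT => [->|k]; last by rewrite lee_fin.
by rewrite mule1.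
Qed.

End poisson_factorial_moment.

Section counting_sums.
Context {R : realType} {T : choiceType}.

Lemma card_fset_set_indic (X A : set T) : finite_set X ->
  (#|` fset_set (X `&` A)|)%:R = \sum_(x \in X) (\1_A x : R).
Proof.
move=> fX; have fXA : finite_set (X `&` A) by exact: finite_setIl.
transitivity (\sum_(x \in X `&` A) (1 : R)).
  rewrite fsbig_finite//= big_const_seq count_predT iter_addr addr0.
  by rewrite cardfE.
rewrite fsbig_mkcondr; apply: eq_fsbigr => x _; rewrite indicE.
by case: (x \in A).
Qed.

(** Pairs of distinct points are all pairs but those on the diagonal. *)
Lemma fsbig_offdiagonal (X : set T) (f g : T -> R) : finite_set X ->
  \sum_(p \in [set p : T * T | [/\ X p.1, X p.2 & p.1 <> p.2]]) f p.1 * g p.2 =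
  (\sum_(x \in X) f x) * (\sum_(y \in X) g y) - \sum_(x \in X) f x * g x.
Proof.
move=> fX; have fXX : finite_set (X `*` X) by exact: finite_setX.
apply/eqP; rewrite -subr_eq opprK eq_sym; apply/eqP.
rewrite mulr_fsuml; under eq_fsbigr do rewrite mulr_fsumr.
rewrite (pair_fsbig _ (fun x y => f x * g y))//=.
rewrite (fsbigID [set p | p.1 <> p.2])//; congr (_ + _).
  by apply: eq_fsbigl; apply/seteqP; split => -[x y] /=; [case=> -[]|case].
transitivity (\sum_(p \in (fun x : T => (x, x)) @` X) f p.1 * g p.2).
  apply: eq_fsbigl; apply/seteqP; split => [[x y] /= [[Xx _] /contrapT xy]|].
    by exists x => //; rewrite xy.
  by move=> _ [x Xx <-]; split => //=; exact.
by rewrite fsbig_image// => x y _ _ [].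
Qed.

End counting_sums.

Lemma ge0_integral_mrestr {dT} {T : measurableType dT} {R : realType}
    (mu : {measure set T -> \bar R}) (D : set T) (mD : measurable D)
    (F : T -> \bar R) :
  measurable_fun setT F -> (forall x, 0 <= F x)%E ->
  (\int[mrestr mu mD]_x F x = \int[mu]_(x in D) F x)%E.
Proof.
move=> mF F0; rewrite -{1}(setUv D) ge0_integral_setU//; last 3 first.
- exact: measurableC.
- exact: measurable_funTS.
- exact/disj_setPCl.
rewrite (null_set_integral (N := ~` D))//; last 3 first.
- exact: measurableC.
- exact: measurable_funTS.
- by change (mu (~` D `&` D) = 0%E); rewrite setICl measure0.
rewrite adde0; apply: eq_measure_integral => A mA AD.
by change (mu (A `&` D) = mu A); rewrite setIidl.
Qed.

(** The measure structure of a product measure in general: inference finds the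
    one that was made for [volume]. *)
Local Notation product_measure :=
  lebesgue_integral_fubini_product_measure1__canonical__measure_function_Measure.

Section poisson_second_moment.
Local Open Scope ereal_scope.
Context {R : realType} {d : nat} {disp : measure_display}.
Context {Omega : measurableType disp} (P : probability Omega R).
Variables (W : set 'rV[R]_d) (t : R) (eta : Omega -> set 'rV[R]_d).
Hypotheses (mW : measurable W) (Wfin : volume W \is a fin_num) (t0 : (0 < t)%R).
Hypothesis eta_poisson : poisson_process P W t eta.

Let n A w : nat := point_count eta A w.

Let v (A : set 'rV[R]_d) : R := (t * fine (volume (A `&` W)))%R.

Let v_ge0 A : (0 <= v A)%R.
Proof. by rewrite mulr_ge0 ?(ltW t0)// fine_ge0. Qed.

Let fin_eta w : finite_set (eta w).
Proof. by have [h _ _ _] := eta_poisson; have [] := h w. Qed.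

Let volW_fin A : measurable A -> volume (A `&` W) \is a fin_num.
Proof.
move=> mA; rewrite ge0_fin_numE ?measure_ge0//.
apply: (@le_lt_trans _ _ (volume W)); last by rewrite -ge0_fin_numE ?measure_ge0.
by apply: le_measure; rewrite ?inE//; exact: measurableI.
Qed.

Let vU A B : measurable A -> measurable B -> A `&` B = set0 ->
  v (A `|` B) = (v A + v B)%R.
Proof.
move=> mA mB AB; rewrite /v -mulrDr -fineD ?volW_fin//; congr (_ * fine _)%R.
rewrite setIUl measureU//; [exact: measurableI|exact: measurableI|].
by rewrite setIACA AB set0I.
Qed.

Let mn A : measurable A -> measurable_fun setT (n A).
Proof. by have [_ h _ _] := eta_poisson; exact: h. Qed.

Let mnR A (g : nat -> R) : measurable A -> measurable_fun setT (fun w => (g (n A w))%:E).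
Proof.
move=> mA; apply/measurable_EFinP; apply: (measurableT_comp (f := g)) => //.
exact: mn.
Qed.

Let nE A w : (n A w)%:R = (\sum_(x \in eta w) (\1_A x : R))%R.
Proof. exact: card_fset_set_indic. Qed.

Let nU A B w : A `&` B = set0 -> n (A `|` B) w = (n A w + n B w)%N.
Proof.
move=> AB; apply/eqP; rewrite -(eqr_nat R) natrD !nE -fsbig_split//; apply/eqP.
apply: eq_fsbigr => x _; rewrite /= !indicE in_setU -natrD; congr (_%:R)%R.
have [xA|xA] := boolP (x \in A); last by [].
rewrite (_ : (x \in B) = false)//; apply/negbTE/negP => xB.
have : (A `&` B) x by split; exact: set_mem.
by rewrite AB.
Qed.

Lemma integral_factorial_moment A : measurable A ->
  \int[P]_w ((n A w * (n A w).-1)%:R)%:E = (v A ^+ 2)%:E.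
Proof.
move=> mA; rewrite -(poisson_factorial_moment (v_ge0 A)).
rewrite -[LHS]/(\int[P]_(w in n A @^-1` setT) ((fun k => ((k * k.-1)%:R)%:E) (n A w))).
rewrite (@ge0_integral_change _ _ _ _ _ P (poisson_prob (v A) 0%N) (n A) (1%:nng)%R)//.
- by rewrite mul1e.
- exact: mn.
- by move=> U _; rewrite mul1e; have [_ _ h _] := eta_poisson; exact: h.
Qed.

(** The counts of [A], [B] and of their disjoint union are all Poisson, so
    that the mixed moment follows by polarization. *)
Lemma integral_product_moment A B : measurable A -> measurable B ->
  A `&` B = set0 ->
  \int[P]_w ((n A w * n B w)%:R)%:E = (v A * v B)%:E.
Proof.
move=> mA mB AB; have mAB : measurable (A `|` B) by exact: measurableU.
set I := (LHS).
have mfac C : measurable C ->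
    measurable_fun setT (fun w => ((n C w * (n C w).-1)%:R)%:E : \bar R).
  by move=> mC; exact: (mnR (fun k => (k * k.-1)%:R)%R mC).
have mprod : measurable_fun setT (fun w => ((n A w * n B w)%:R)%:E : \bar R).
  under eq_fun do rewrite natrM EFinM.
  apply: emeasurable_funM; [exact: (mnR (fun k => k%:R)%R mA)|exact: (mnR (fun k => k%:R)%R mB)].
have : ((v A + v B) ^+ 2)%:E = (v A ^+ 2)%:E + (v B ^+ 2)%:E + 2%:E * I.
  rewrite -vU// -!integral_factorial_moment//.
  rewrite -ge0_integralZl// -ge0_integralD//; last 2 first.
  - exact: mfac.
  - exact: mfac.
  rewrite -ge0_integralD//; last 3 first.
  - by move=> w _; rewrite adde_ge0.
  - by apply: emeasurable_funD; exact: mfac.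
  - exact: measurable_funeM.
  apply: eq_integral => w _; rewrite -EFinM -!EFinD -natrM -!natrD; congr (_%:R)%:E.
  rewrite nU//; set a := n A w; set b := n B w.
  case: a b => [|a] [|b]; rewrite ?addn0 ?muln0 ?add0n// ?addSn /= ?addn0//; ring.
have I0 : 0 <= I by apply: integral_ge0 => w _; rewrite lee_fin.
move: I I0 => [I| |]//= I0; rewrite -?EFinM -?EFinD.
  move=> [h]; congr EFin; rewrite sqrrD in h; lra.
by rewrite mulry gtr0_sg// mul1e addey.
Qed.

Let pairs w : seq ('rV[R]_d * 'rV[R]_d) := fset_set (distinct_pairs (eta w)).

Let pair_sumE w (f : 'rV[R]_d * 'rV[R]_d -> R) :
  (\sum_(p <- pairs w) f p = \sum_(p \in distinct_pairs (eta w)) f p)%R.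
Proof.
rewrite fsbig_finite//; apply: (@sub_finite_set _ _ (eta w `*` eta w)).
  by move=> p [].
exact: finite_setX.
Qed.

(** Among the ordered pairs of points in [A `*` B], those on the diagonal come
    from points of [A `&` B]. Splitting [A] and [B] along [A `&` B] leaves
    factorial moments and counts of disjoint sets. *)
Let pairs_in_rectangle A B w :
  let C := A `&` B in let A' := A `\` B in let B' := B `\` A in
  \sum_(p <- pairs w) (\1_(A `*` B) p : R)%:E =
  ((n C w * (n C w).-1)%:R)%:E + ((n C w * n B' w)%:R)%:E +
  ((n A' w * n C w)%:R)%:E + ((n A' w * n B' w)%:R)%:E.
Proof.
move=> C A' B'; rewrite sumEFin -!EFinD -!natrD; congr EFin.
have nA : n A w = (n C w + n A' w)%N.
  rewrite -nU ?setUIDK//.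
  by apply/seteqP; split => x // [[_ Bx] [_ /(_ Bx)]].
have nB : n B w = (n C w + n B' w)%N.
  rewrite /C setIC -nU ?setUIDK//.
  by apply/seteqP; split => x // [[_ Bx] [_ /(_ Bx)]].
transitivity ((n A w)%:R * (n B w)%:R - (n C w)%:R : R)%R.
  rewrite !nE pair_sumE.
  transitivity (\sum_(p \in distinct_pairs (eta w)) (\1_A p.1 * \1_B p.2 : R))%R.
    by apply: eq_fsbigr => p _; rewrite !indicE in_setX -natrM mulnb.
  rewrite fsbig_offdiagonal//; congr (_ - _)%R; apply: eq_fsbigr => x _.
  by rewrite !indicE in_setI -natrM mulnb.
rewrite nA nB; case: (n C w) => [|c]; rewrite !natrD !natrM ?natrD; ring.
Qed.

Let rectangle_intensity A B : measurable A -> measurable B ->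
  measurable_fun setT
    (fun w => \sum_(p <- pairs w) (\1_(A `*` B) p : R)%:E) /\
  \int[P]_w \sum_(p <- pairs w) (\1_(A `*` B) p : R)%:E = (v A * v B)%:E.
Proof.
move=> mA mB; set C := A `&` B; set A' := A `\` B; set B' := B `\` A.
have mC : measurable C by exact: measurableI.
have mA' : measurable A' by exact: measurableD.
have mB' : measurable B' by exact: measurableD.
have CA' : C `&` A' = set0.
  by apply/seteqP; split => x // [[_ Bx] [_ /(_ Bx)]].
have CB' : C `&` B' = set0.
  by apply/seteqP; split => x // [[Ax _] [_ /(_ Ax)]].
have A'B' : A' `&` B' = set0.
  by apply/seteqP; split => x // [[Ax _] [_ /(_ Ax)]].
have mprod D E : measurable D -> measurable E ->
    measurable_fun setT (fun w => ((n D w * n E w)%:R)%:E : \bar R).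
  move=> mD mE; under eq_fun do rewrite natrM EFinM.
  by apply: emeasurable_funM; exact: (mnR (fun k => k%:R)%R).
have mfac : measurable_fun setT (fun w => ((n C w * (n C w).-1)%:R)%:E : \bar R).
  exact: (mnR (fun k => (k * k.-1)%:R)%R mC).
have m2 := emeasurable_funD mfac (mprod C B' mC mB').
have m3 := emeasurable_funD m2 (mprod A' C mA' mC).
rewrite (_ : (fun w => \sum_(p <- pairs w) _) = fun w =>
    ((n C w * (n C w).-1)%:R)%:E + ((n C w * n B' w)%:R)%:E +
    ((n A' w * n C w)%:R)%:E + ((n A' w * n B' w)%:R)%:E); last first.
  by apply/funext => w; exact: pairs_in_rectangle.
split; first exact: emeasurable_funD m3 (mprod A' B' mA' mB').
rewrite ge0_integralD//; last 2 first.
- by move=> w _; rewrite -!EFinD lee_fin.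
- exact: mprod.
rewrite ge0_integralD//; last 2 first.
- by move=> w _; rewrite -!EFinD lee_fin.
- exact: mprod.
rewrite ge0_integralD//; last exact: mprod.
rewrite integral_factorial_moment// !integral_product_moment//; last first.
  by rewrite setIC.
have vA : v A = (v C + v A')%R by rewrite -vU// setUIDK.
have vB : v B = (v C + v B')%R by rewrite -vU// /C setIC setUIDK.
by rewrite vA vB -!EFinD; congr EFin; ring.
Qed.

Let mWW : measurable (W `*` W). Proof. exact: measurableX. Qed.

(** The second factorial moment measure of a Poisson process is the square of
    its intensity measure: they agree on rectangles, which form a pi-system. *)
Lemma poisson_pair_campbell (F : 'rV[R]_d * 'rV[R]_d -> \bar R) :
  measurable_fun setT F -> (forall p, 0 <= F p) ->
  measurable_fun setT (fun w => \sum_(p <- pairs w) F p) /\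
  \int[P]_w \sum_(p <- pairs w) F p =
    (t ^+ 2)%:E * \int[volume \x volume]_(p in W `*` W) F p.
Proof.
move=> mF F0.
have t2 : (0 <= t ^+ 2)%R by rewrite sqr_ge0.
pose vol2 := product_measure (@volume R d) (@volume R d).
pose volW2 : {measure set _ -> \bar R} := mrestr vol2 mWW.
pose nu : {measure set _ -> \bar R} :=
  mscale (NngNum t2) volW2.
have nuE : \int[nu]_p F p = (t ^+ 2)%:E * \int[volume \x volume]_(p in W `*` W) F p.
  rewrite ge0_integral_mscale//; congr (_ * _).
  exact: ge0_integral_mrestr.
have nuX A B : measurable A -> measurable B -> nu (A `*` B) = (v A * v B)%:E.
  move=> mA mB.
  transitivity ((t ^+ 2)%:E * (volume (A `&` W) * volume (B `&` W))).
    transitivity ((t ^+ 2)%:E *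
      (volume \x volume) ((A `*` B) `&` (W `*` W))); first by [].
    congr (_ * _); rewrite -setXI; apply: product_measure1E; exact: measurableI.
  rewrite -(fineK (volW_fin mA)) -(fineK (volW_fin mB)) -!EFinM /v.
  by congr EFin; ring.
rewrite -nuE; apply: campbell_formula => // E mE.
apply: (@intensity_pi_lambda _ _ _ _ _ P nu pairs
  [set A `*` B | A in measurable & B in measurable]) => //.
- move=> _ _ [A1 mA1 [B1 mB1 <-]] [A2 mA2 [B2 mB2 <-]].
  exists (A1 `&` A2); first exact: measurableI.
  by exists (B1 `&` B2); [exact: measurableI|rewrite setXI].
- by exists setT => //; exists setT => //; rewrite setXTT.
- exact: measurable_prod_measurableType.
- by rewrite -setXTT nuX// ltry.
- move=> _ [A mA [B mB <-]]; have [h1 h2] := rectangle_intensity mA mB.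
  by split => //; rewrite h2 nuX.
Qed.

End poisson_second_moment.

(** * The expected total length *)

Section covariogram_integral.
Local Open Scope ereal_scope.
Context {R : realType} {d : nat}.
Variables (W : set 'rV[R]_d) (f : 'rV[R]_d -> \bar R).
Hypotheses (cW : compact W) (mf : measurable_fun setT f).
Hypothesis f0 : forall z, 0 <= f z.

(** Substituting [x = y + z] and integrating in [y] first leaves the volume of
    the points [y] of [W] with [y + z] in [W]. *)
Lemma integral_covariogram :
  \int[@volume R d \x @volume R d]_(p in W `*` W) f (p.1 - p.2)%R =
  \int[volume]_z (f z * covariogram W z).
Proof.
have mW : measurable W by exact: compact_measurable_rV.
pose h y z : \bar R := (\1_W y)%:E * (\1_W (z + y)%R)%:E * f z.
have h0 y z : 0 <= h y z by rewrite !mule_ge0// lee_fin.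
have mh (dT : measure_display) (T : measurableType dT) (u v : T -> 'rV[R]_d) :
    measurable_fun setT u -> measurable_fun setT v ->
    measurable_fun setT (fun p => h (u p) (v p)).
  move=> mu mv; apply: emeasurable_funM; last exact: measurableT_comp mf mv.
  apply: emeasurable_funM; first exact: measurable_indic_comp.
  by apply: measurable_indic_comp => //; exact: measurable_rV_add.
have msub (dT : measure_display) (T : measurableType dT) (u v : T -> 'rV[R]_d) :
    measurable_fun setT u -> measurable_fun setT v ->
    measurable_fun setT (fun p => u p - v p)%R.
  by move=> mu mv; apply: measurable_rV_add => //; exact: measurable_rV_opp.
transitivity (\int[@volume R d \x @volume R d]_p h p.2 (p.1 - p.2)%R).
  transitivity (\int[@volume R d \x @volume R d]_p
      ((\1_(W `*` W) p)%:E * f (p.1 - p.2)%R)).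
    exact: (integral_mul_indic (product_measure (@volume R d) (@volume R d))).
  congr integral; apply/funext => p; rewrite /h subrK -EFinM !indicE in_setX -natrM mulnb.
  by rewrite andbC.
transitivity (\int[volume]_y \int[volume]_x h y (x - y)%R).
  apply: (fubini_tonelli2 (fun p : 'rV[R]_d * 'rV[R]_d => h p.2 (p.1 - p.2)%R)) => //.
  by apply: mh; [exact: measurable_snd|apply: msub; [exact: measurable_fst|exact: measurable_snd]].
transitivity (\int[volume]_y \int[volume]_z h y z).
  apply: eq_integral => y _.
  rewrite -(ge0_integral_volumeD y (f := fun x => h y (x - y)%R))//; last first.
    apply: mh; first exact: measurable_cst.
    by apply: msub; [exact: measurable_id|exact: measurable_cst].
  by apply: eq_integral => z _; rewrite addrK.
transitivity (\int[volume]_z \int[volume]_y h y z).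
  apply: (fubini_tonelli (fun p : 'rV[R]_d * 'rV[R]_d => h p.1 p.2)) => //.
  exact: mh measurable_fst measurable_snd.
apply: eq_integral => z _.
pose Wz : set 'rV[R]_d := (fun y => y + z)%R @^-1` (W `&` translate W z).
have mWz : measurable (W `&` translate W z).
  by apply: measurableI => //; exact: measurable_translate.
transitivity (\int[volume]_y (f z * (\1_Wz y)%:E)).
  apply: eq_integral => y _; rewrite /h muleC -EFinM; congr (_ * _%:E).
  rewrite !indicE -natrM mulnb; congr (nat_of_bool _)%:R.
  apply/idP/idP => [/andP[/set_mem Wy /set_mem Wzy]|/set_mem[/= Wyz Wy]].
    by apply/mem_set; split => /=; [rewrite addrC|rewrite /translate /= addrK].
  move: Wy; rewrite /translate /= addrK => Wy.
  by rewrite (mem_set Wy) addrC (mem_set Wyz).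
have mWz' : measurable Wz.
  apply: measurable_preimage mWz.
  by apply: measurable_rV_add; [exact: measurable_id|exact: measurable_cst].
transitivity (f z * \int[volume]_y (\1_Wz y)%:E).
  apply: ge0_integralZl => //.
  exact/measurable_EFinP/measurable_indicP.
congr (_ * _); transitivity (volume Wz); first exact: integral_volume_indic.
by rewrite /covariogram image_translate; exact: volumeD.
Qed.

End covariogram_integral.

Section expected_length_power.
Local Open Scope ereal_scope.
Context {R : realType} {d : nat} {disp : measure_display}.
Context {Omega : measurableType disp} (P : probability Omega R).
Variables (W : set 'rV[R]_d) (t : R) (eta : Omega -> set 'rV[R]_d).
Hypotheses (cW : compact W) (t0 : (0 < t)%R).
Hypothesis eta_poisson : poisson_process P W t eta.

Lemma expected_length_power (tau delta : R) :
  'E_P[fun w => length_power tau delta (eta w)] =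
  (t ^+ 2 / 2)%:E *
    \int[volume]_(y in eball delta) ((enorm y `^ tau)%:E * covariogram W y).
Proof.
pose f (z : 'rV[R]_d) : \bar R := (\1_(eball delta) z)%:E * (enorm z `^ tau)%:E.
have mf : measurable_fun setT f.
  apply: emeasurable_funM; last exact: measurable_enorm_powR.
  by apply: measurable_indic_comp => //; exact: measurable_eball.
have f0 z : 0 <= f z by rewrite mule_ge0// lee_fin powR_ge0.
pose F (p : 'rV[R]_d * 'rV[R]_d) := f (p.1 - p.2)%R.
have mF : measurable_fun setT F.
  apply: (measurableT_comp mf); apply: measurable_rV_add; first exact: measurable_fst.
  by apply: measurable_rV_opp; exact: measurable_snd.
have [mS intS] := poisson_pair_campbell (compact_measurable_rV cW)
  (compact_volume_fin_num cW) t0 eta_poisson mF (fun p => f0 _).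
rewrite unlock.
transitivity (\int[P]_w (2^-1%:E *
    \sum_(p <- fset_set (distinct_pairs (eta w))) F p)).
  apply: eq_integral => w _; rewrite /length_power EFinM; congr (_ * _).
  have [eta_fin _ _ _] := eta_poisson; have [fin_w _] := eta_fin w.
  have fin_pairs : finite_set (distinct_pairs (eta w)).
    apply: (@sub_finite_set _ _ (eta w `*` eta w)); first by move=> p [].
    exact: finite_setX.
  rewrite fsbig_finite// -sumEFin; apply: eq_bigr => p _.
  rewrite EFinM /F /f; congr (_%:E * _); rewrite indicE; congr (nat_of_bool _)%:R.
  by apply/idP/idP => [h|/set_mem]; first exact: mem_set.
rewrite ge0_integralZl//; last by move=> w _; apply: sume_ge0 => p _; exact: f0.
rewrite intS integral_covariogram// muleA -EFinM [(2^-1 * _)%R]mulrC; congr (_ * _).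
transitivity (\int[volume]_z ((\1_(@eball R d delta) z)%:E *
    ((enorm z `^ tau)%:E * covariogram W z))).
  by apply: eq_integral => z _; rewrite /f muleA.
by apply/esym; exact: integral_mul_indic.
Qed.

End expected_length_power.

(** * The distance of the mean from its limit *)

Section length_deficit.
Local Open Scope ereal_scope.
Context {R : realType} {n : nat}.
Variables (W : set 'rV[R]_n.+1) (tau delta : R).
Hypotheses (cW : compact W) (htau : (- n.+1%:R < tau)%R) (delta0 : (0 < delta)%R).

Let c : R := delta `^ (tau + n.+1%:R).

Let q (y : 'rV[R]_n.+1) : \bar R := (enorm y `^ tau)%:E.

Let I := \int[volume]_(y in eball delta) (q y * covariogram W y).
Let D := \int[volume]_(y in eball delta) (q y * deficit W y).

Let c_gt0 : (0 < c)%R. Proof. exact: powR_gt0. Qed.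

Let tau_gt0 : (0 < tau + n.+1%:R)%R. Proof. by move: htau; lra. Qed.

Let covariogram_add_deficit :
  I + D = (c * (n.+1%:R * @kappa R n.+1 / (tau + n.+1%:R)))%:E * volume W.
Proof.
have mE : measurable (@eball R n.+1 delta) by exact: measurable_eball.
have q0 y : 0 <= q y by rewrite lee_fin powR_ge0.
have cov0 y : 0 <= covariogram W y by exact: measure_ge0.
have mq : measurable_fun setT q by exact: measurable_enorm_powR.
have mdef := measurable_deficit cW.
have Wfin : volume W \is a fin_num by exact: compact_volume_fin_num.
have def_fin y : deficit W y \is a fin_num.
  by move: Wfin; rewrite -(covariogram_deficit cW y) fin_numD => /andP[].
have mcov : measurable_fun setT (covariogram W).
  rewrite (_ : covariogram W = cst (volume W) \- deficit W).
    by apply: emeasurable_funB => //; exact: measurable_cst.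
  apply/funext => y; change (covariogram W y = volume W - deficit W y).
  by rewrite -(covariogram_deficit cW y) addeK.
transitivity (\int[volume]_(y in eball delta) (q y * volume W)).
  rewrite -ge0_integralD//; last 4 first.
  - by move=> y _; rewrite mule_ge0.
  - by apply: measurable_funTS; exact: emeasurable_funM.
  - by move=> y _; rewrite mule_ge0// deficit_ge0.
  - by apply: measurable_funTS; exact: emeasurable_funM.
  apply: eq_integral => y _.
  by rewrite -ge0_muleDr ?deficit_ge0// covariogram_deficit.
transitivity (\int[volume]_(y in eball delta) q y * volume W).
  by apply: ge0_integralZr => //; exact: measurable_funTS.
congr (_ * _).
by rewrite /I integral_enorm_powR_eball// [(n.+1%:R + tau)%R]addrC.
Qed.

(** Integrating [covariogram W y + deficit W y = volume W] against [|y|^tau]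
    relates [I] to [D]; all terms are finite. *)
Lemma limit_sub_mean :
  (n.+1%:R * @kappa R n.+1 / (2 * (tau + n.+1%:R)))%:E * volume W
    - (2^-1 * c^-1)%:E * I = (2^-1 * c^-1)%:E * D.
Proof.
have vE : volume W = (fine (volume W))%:E.
  by rewrite fineK// compact_volume_fin_num.
have D0 : 0 <= D.
  apply: integral_ge0 => y _.
  by rewrite mule_ge0// ?deficit_ge0// lee_fin powR_ge0.
have I0 : 0 <= I.
  apply: integral_ge0 => y _.
  by rewrite mule_ge0// ?measure_ge0// lee_fin powR_ge0.
move: covariogram_add_deficit; rewrite vE -EFinM.
move: I D I0 D0 => [i| |]//[dd| |]// _ _; rewrite -!EFinM -EFinB -EFinD => -[h].
congr EFin; have -> : dd = (c * (n.+1%:R * @kappa R n.+1 / (tau + n.+1%:R)) *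
  fine (volume W) - i)%R by rewrite -h addrC addKr.
by field; rewrite nat1r !gt_eqF.
Qed.

End length_deficit.

Theorem theorem3p1 (R : realType) (d : nat) (hd : (1 <= d)%N)
  (W : set 'rV[R]_d) (Wcompact : compact W) (Wconvex : convex_set W)
  (Wvol : (0 < volume W)%E)
  (disp : measure_display) (Omega : measurableType disp)
  (P : probability Omega R)
  (eta : R -> Omega -> set 'rV[R]_d)
  (eta_poisson : forall t : R, 0 < t -> poisson_process P W t (eta t))
  (delta : R -> R) (delta_gt0 : forall t : R, 0 < t -> 0 < delta t)
  (delta_cvg0 : delta t @[t --> +oo] --> 0)
  (tau : R) (htau : - d%:R < tau)
  (t : R) (ht : 0 < t) :
  let EL := ('E_P[fun w => length_power tau (delta t) (eta t w)])%E in
  (EL = (t ^+ 2 / 2)%:E *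
    \int[volume]_(y in eball (delta t)) ((enorm y `^ tau)%:E * covariogram W y))%E
  /\
  (0 <= (d%:R * kappa d / (2 * (tau + d%:R)))%:E * volume W
        - EL * ((t ^+ 2 * delta t `^ (tau + d%:R))^-1)%:E
     <= (kappa d.-1 / (2 * (tau + d%:R + 1)) * delta t)%:E * surface_area W)%E.
Proof.
move=> EL; have ELE := expected_length_power Wcompact ht (eta_poisson t ht) tau (delta t).
split; first exact: ELE.
rewrite /EL ELE {EL ELE eta eta_poisson delta_cvg0}.
move: (delta t) (delta_gt0 t ht) => e e0 {delta delta_gt0}.
case: d hd W Wcompact Wconvex Wvol htau => // n _ W cW convW W0 htau.
have c0 : 0 < e `^ (tau + n.+1%:R) by exact: powR_gt0.
have normalize (I : \bar R) :
    ((t ^+ 2 / 2)%:E * I * ((t ^+ 2 * e `^ (tau + n.+1%:R))^-1)%:E =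
     (2^-1 * (e `^ (tau + n.+1%:R))^-1)%:E * I)%E.
  rewrite muleC muleA -EFinM; congr (_%:E * _)%E.
  by field; rewrite !gt_eqF.
rewrite normalize {normalize}.
rewrite limit_sub_mean//; apply/andP; split.
  rewrite mule_ge0 ?lee_fin ?mulr_ge0 ?invr_ge0 ?(ltW c0)//.
  apply: integral_ge0 => y _.
  by rewrite mule_ge0// ?deficit_ge0// lee_fin powR_ge0.
have /= bound := deficit_integral_le cW convW W0 htau e0.
apply: le_trans (lee_wpmul2l _ bound) _.
  by rewrite lee_fin mulr_ge0 ?invr_ge0 ?(ltW c0).
rewrite muleA -EFinM le_eqVlt; apply/orP; left; apply/eqP; congr (_%:E * _)%E.
have tau0 : 0 < tau + n.+1%:R + 1 by move: htau; lra.
by field; rewrite nat1r !gt_eqF.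
Qed.
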